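(* Consider combinatorial auctions with bidder and item conflicts in which the bidders have fractionally sub-additive valuations, the bidder conflict graph $G$ has maximum out-degree $\Delta\ge 1$, and the item conflict graph $G_I$ has maximum out-degree $\Delta_I\ge 1$. Given a deterministic $\alpha$-approximation algorithm $f$ for combinatorial auctions without conflicts (with fractionally sub-additive valuations), there exists a deterministic $\left(\frac{16\alpha}{3}\cdot\min\{\Delta,\Delta_I\}\right)$-approximation algorithm $f^c$ for combinatorial auctions with bidder and item conflicts. Moreover, if $f$ is maximal-in-range, then $f^c$ can be chosen to be maximal-in-range and truthful.
   Context: Combinatorial auction (CA): a finite set $B$ of $n$ bidders and a finite set $I$ of $m$ items; each bidder $i\in B$ has a valuation $v_i:2^I\to\mathbb{R}_{\ge 0}$. An allocation is a tuple $S=(S_i)_{i\in B}$ of pairwise disjoint subsets of $I$ (not all items need be assigned). Without conflicts, the social welfare of $S$ is $\sum_{i\in B} v_i(S_i)$. CA with bidder and item conflicts: additionally there are directed graphs $G=(B,E)$ (bidder conflict graph) and $G_I=(I,E_I)$ (item conflict graph), which are public. For an allocation $S$, bidder $i$ has the set of useless items $D_i=\{k\in S_i \mid \exists j\in B,\ \exists \ell\in S_j:\ (i,j)\in E \text{ and } (k,\ell)\in E_I\}$, and $v_i^c(S)=v_i(S_i\setminus D_i)$. The social welfare is $SW(S)=\sum_{i\in B} v_i^c(S)$. A valuation $v:2^I\to\mathbb{R}$ is fractionally sub-additive if for all $S,T_1,\dots,T_k\in 2^I$ and $0\le\alpha_1,\dots,\alpha_k\le 1$: if $\sum_{\ell:\,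 j\in T_\ell}\alpha_\ell\ge 1$ for all $j\in S$, then $v(S)\le\sum_{\ell=1}^k\alpha_\ell v(T_\ell)$. An $\alpha$-approximation algorithm outputs, for every instance, an allocation whose social welfare is at least $1/\alpha$ times the maximum social welfare over all allocations (of the respective problem). An algorithm $f$ is maximal-in-range if there is a subset $A'$ of the set $A$ of allocations (not depending on the valuations) such that $f(v_1,\dots,v_n)\in\arg\max_{S\in A'}\sum_{i\in B} v_i(S)$ for all valuations, where $v_i(S)$ is bidder $i$'s value for allocation $S$ (i.e. $v_i(S_i)$ without conflicts, $v_i^c(S)$ with conflicts). An algorithm is truthful if there is a payment scheme $p$ such that reporting the true valuation $v_i$ is a dominant strategy for each bidder $i$, whose utility is the value of the allocation minus the payment $p_i$. Algorithms are polynomial-time: if $f$ runs in polynomial time, then $f^c$ (which uses $f$ as a subroutine) is required to run in polynomial time. *)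

(* Defs.v *)
From HB Require Import structures.
From mathcomp Require Import all_boot all_order all_algebra.
From mathcomp Require Import reals.

Set Implicit Arguments.
Unset Strict Implicit.
Unset Printing Implicit Defensive.

Import Order.TTheory GRing.Theory Num.Theory.
Local Open Scope ring_scope.

Section Auctions.

Variable R : realType.

Definition valuation (m : nat) := {set 'I_m} -> R.

Definition profile (n m : nat) := 'I_n -> valuation m.

Definition bundles (n m : nat) := {ffun 'I_n -> {set 'I_m}}.

Definition is_allocation n m (S : bundles n m) : bool :=
  [forall i, forall j, (i != j) ==> [disjoint S i & S j]].

Definition nonnegative m (u : valuation m) : Prop := forall S, 0 <= u S.

Definition fractionally_subadditive m (u : valuation m) : Prop :=
  forall (S : {set 'I_m}) (k : nat) (T : 'I_k -> {set 'I_m}) (a : 'I_k -> R),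
    (forall l, 0 <= a l <= 1) ->
    (forall j, j \in S -> 1 <= \sum_(l < k | j \in T l) a l) ->
    u S <= \sum_(l < k) a l * u (T l).

Definition admissible m (u : valuation m) : Prop :=
  nonnegative u /\ fractionally_subadditive u.

Definition admissible_profile n m (v : profile n m) : Prop :=
  forall i, admissible (v i).

Definition max_outdegree (T : finType) (E : rel T) : nat :=
  (\max_(x : T) #|[set y | E x y]|)%N.

Definition useless n m (E : rel 'I_n) (EI : rel 'I_m) (S : bundles n m)
    (i : 'I_n) : {set 'I_m} :=
  [set k in S i | [exists j, exists l in S j, E i j && EI k l]].

(* A bidder is never in conflict with himself.  The two items of a conflict then
   belong to different bidders, hence are distinct, so that loops of EI have no
   effect on the useless items and need not be excluded. *)
Definition conflict_graphs n m (E : rel 'I_n) (EI : rel 'I_m) : Prop :=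
  [/\ irreflexive E, (1 <= max_outdegree E)%N & (1 <= max_outdegree EI)%N].

(* The value that a bidder [i] with valuation [u] has for the outcome [S];
   the two problems differ only in this function. *)
Definition outcome_value n m := valuation m -> bundles n m -> 'I_n -> R.

Definition plain_value n m : outcome_value n m := fun u S i => u (S i).

Definition conflict_value n m (E : rel 'I_n) (EI : rel 'I_m) :
    outcome_value n m :=
  fun u S i => u (S i :\: useless E EI S i).

Section Mechanisms.

Variables (n m : nat) (value : outcome_value n m).

Definition welfare (v : profile n m) (S : bundles n m) : R :=
  \sum_(i < n) value (v i) S i.

Definition optimum (v : profile n m) : R :=
  \big[Num.max/0]_(S : bundles n m | is_allocation S) welfare v S.

Definition approximates (alpha : R) (g : profile n m -> bundles n m) : Prop :=
  forall v, admissible_profile v ->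
    is_allocation (g v) /\ alpha^-1 * optimum v <= welfare v (g v).

Definition maximal_in_range (g : profile n m -> bundles n m) : Prop :=
  exists A : {set bundles n m},
    (forall S, S \in A -> is_allocation S) /\
    forall v, admissible_profile v ->
      g v \in A /\ forall S, S \in A -> welfare v S <= welfare v (g v).

Definition misreport (v : profile n m) (i : 'I_n) (w : valuation m) :
    profile n m :=
  fun j => if j == i then w else v j.

Definition truthful (g : profile n m -> bundles n m) : Prop :=
  exists p : profile n m -> 'I_n -> R,
    forall (v : profile n m) (i : 'I_n) (w : valuation m),
      admissible_profile v -> admissible w ->
      value (v i) (g (misreport v i w)) i - p (misreport v i w) i
        <= value (v i) (g v) i - p v i.

End Mechanisms.

End Auctions.

(* Model of computation: Jones's WHILE language over binary trees, extended
   with exact real arithmetic at the leaves (as in the BSS model: field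
   operations and comparison at unit cost, no rounding, and no real constants
   in programs other than 0 and 1) and with value queries.  Expressions have a
   size fixed by the program, so evaluating one is charged one step.  Variables
   are numbered. *)

Inductive data (R : Type) : Type :=
| Leaf
| Atom (x : R)
| Node (d e : data R).
Arguments Leaf {R}.

Inductive expr : Type :=
| Var (x : nat)
| Nil_
| Cons (a b : expr)
| Hd (a : expr)
| Tl (a : expr)
| Zero
| One
| Add (a b : expr)
| Sub (a b : expr)
| Mul (a b : expr)
| Div (a b : expr)
| Le (a b : expr).

Inductive prog : Type :=
| Skip
| Assign (x : nat) (a : expr)
| Query (x : nat) (a b : expr)
| Seq (c c' : prog)
| If (a : expr) (c c' : prog)
| While (a : expr) (c : prog).

Section Semantics.

Variable R : realType.

Local Notation data := (data R).

Definition store := nat -> data.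

Definition update (s : store) (x : nat) (d : data) : store :=
  fun y => if y == x then d else s y.

Definition truth (d : data) : bool := if d is Leaf then false else true.

Definition enc_bool (b : bool) : data := if b then Node Leaf Leaf else Leaf.

Definition data_head (d : data) : data := if d is Node e _ then e else Leaf.

Definition data_tail (d : data) : data := if d is Node _ e then e else Leaf.

Definition arith (op : R -> R -> R) (d e : data) : data :=
  match d, e with Atom x, Atom y => Atom (op x y) | _, _ => Leaf end.

Definition compare (d e : data) : data :=
  match d, e with Atom x, Atom y => enc_bool (x <= y) | _, _ => Leaf end.

Fixpoint eval (s : store) (a : expr) : data :=
  match a with
  | Var x => s x
  | Nil_ => Leaf
  | Cons a b => Node (eval s a) (eval s b)
  | Hd a => data_head (eval s a)
  | Tl a => data_tail (eval s a)
  | Zero => Atom 0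
  | One => Atom 1
  | Add a b => arith (fun x y => x + y) (eval s a) (eval s b)
  | Sub a b => arith (fun x y => x - y) (eval s a) (eval s b)
  | Mul a b => arith (fun x y => x * y) (eval s a) (eval s b)
  | Div a b => arith (fun x y => x / y) (eval s a) (eval s b)
  | Le a b => compare (eval s a) (eval s b)
  end.

(* [exec o c s t s'] : with oracle [o], [c] started in [s] halts in [s'] after
   [t] steps. *)
Inductive exec (o : data -> data -> data) :
    prog -> store -> nat -> store -> Prop :=
| ExecSkip s : exec o Skip s 1 s
| ExecAssign s x a : exec o (Assign x a) s 1 (update s x (eval s a))
| ExecQuery s x a b :
    exec o (Query x a b) s 1 (update s x (o (eval s a) (eval s b)))
| ExecSeq c c' s t s' t' s'' :
    exec o c s t s' -> exec o c' s' t' s'' ->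
    exec o (Seq c c') s (t + t')%N s''
| ExecIfTrue a c c' s t s' :
    truth (eval s a) -> exec o c s t s' -> exec o (If a c c') s t.+1 s'
| ExecIfFalse a c c' s t s' :
    ~~ truth (eval s a) -> exec o c' s t s' -> exec o (If a c c') s t.+1 s'
| ExecWhileFalse a c s : ~~ truth (eval s a) -> exec o (While a c) s 1 s
| ExecWhileTrue a c s t s' t' s'' :
    truth (eval s a) -> exec o c s t s' -> exec o (While a c) s' t' s'' ->
    exec o (While a c) s (t + t').+1 s''.

(* Input and output are passed in variable 0. *)
Definition run (o : data -> data -> data) (c : prog) (d : data) (t : nat)
    (d' : data) : Prop :=
  exists2 s, exec o c (update (fun=> Leaf) 0%N d) t s & s 0%N = d'.

Definition enc_seq (s : seq data) : data := foldr (@Node R) Leaf s.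

Definition enc_nat (k : nat) : data := enc_seq (nseq k Leaf).

Definition enc_set m (A : {set 'I_m}) : data :=
  enc_seq [seq enc_bool (k \in A) | k <- enum 'I_m].

Definition enc_rel n (E : rel 'I_n) : data :=
  enc_seq [seq enc_set [set j | E i j] | i <- enum 'I_n].

Definition enc_bundles n m (S : bundles n m) : data :=
  enc_seq [seq enc_set (S i) | i <- enum 'I_n].

Fixpoint dec_nat (d : data) : nat :=
  if d is Node _ e then (dec_nat e).+1 else 0%N.

Definition dec_set m (d : data) : {set 'I_m} :=
  [set k : 'I_m | truth (data_head (iter k data_tail d))].

(* A query with a bidder [i] (in unary) and a set of items (as a list of bits)
   returns the value of this set to bidder [i]; this is the only access of a
   program to the valuations. *)
Definition value_oracle n m (v : profile R n m) (d e : data) : data :=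
  if insub (dec_nat d) is Some i then Atom (v i (dec_set m e)) else Leaf.

Definition ca_input (n m : nat) : data := enc_seq [:: enc_nat n; enc_nat m].

Definition cac_input n m (E : rel 'I_n) (EI : rel 'I_m) : data :=
  enc_seq [:: enc_nat n; enc_nat m; enc_rel E; enc_rel EI].

Definition ca_algorithm :=
  forall n m : nat, profile R n m -> bundles n m.

Definition cac_algorithm :=
  forall n m : nat, rel 'I_n -> rel 'I_m -> profile R n m -> bundles n m.

Definition ca_computes (P : prog) (f : ca_algorithm) : Prop :=
  forall n m (v : profile R n m), admissible_profile v ->
    exists t, run (value_oracle v) P (ca_input n m) t (enc_bundles (f n m v)).

Definition cac_computes (P : prog) (f : cac_algorithm) : Prop :=
  forall n m (E : rel 'I_n) (EI : rel 'I_m) (v : profile R n m),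
    conflict_graphs E EI -> admissible_profile v ->
    exists t, run (value_oracle v) P (cac_input E EI) t
                  (enc_bundles (f n m E EI v)).

Definition ca_polytime (P : prog) : Prop :=
  exists c k : nat, forall n m (v : profile R n m), admissible_profile v ->
    exists t d, run (value_oracle v) P (ca_input n m) t d /\
                (t <= c * (n + m).+1 ^ k)%N.

Definition cac_polytime (P : prog) : Prop :=
  exists c k : nat, forall n m (E : rel 'I_n) (EI : rel 'I_m)
      (v : profile R n m),
    conflict_graphs E EI -> admissible_profile v ->
    exists t d, run (value_oracle v) P (cac_input E EI) t d /\
                (t <= c * (n + m).+1 ^ k)%N.

End Semantics.

(* Main.v *)
From Pilot Require Import Defs.
From mathcomp Require Import all_boot all_order all_algebra.
From mathcomp Require Import reals.
From mathcomp Require Import zify ring lra.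
(* MathComp's sequences shadow the constructor [Cons]. *)
Import Pilot.Defs.

Set Implicit Arguments.
Unset Strict Implicit.
Unset Printing Implicit Defensive.

Import Order.TTheory GRing.Theory Num.Theory.
Local Open Scope ring_scope.

(* Forget the loops of both graphs.  A graph of maximum out-degree D can be
   coloured with 2D + 1 colours: some vertex of every induced subgraph has
   in-degree at most D, so peel off such vertices one by one and colour them
   first-fit in reverse order, when each has at most 2D coloured neighbours.

   Restricting the auction to one colour class of bidders, or to one colour
   class of items, makes every allocation conflict free, and replaces each
   valuation v_i by A |-> v_i (A :&: J_i) for bundles J that depend on the
   graphs only.  By subadditivity the optima of the restricted auctions sum up
   to at least the original optimum.  Hence running f on each of the restricted
   auctions and keeping the best outcome loses a factor
   (2 min(Delta, Delta_I) + 1) alpha, and 2D + 1 <= 3D <= 16D/3 for D >= 1.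
   The colour classes do not depend on the valuations, so this preserves being
   maximal-in-range, and VCG payments make the result truthful.

   For polynomial time, the algorithm is written in a small functional language
   whose loops range over {0, ..., n-1} or {0, ..., m-1} only, so that its
   running time is bounded syntactically by a polynomial. *)

(** * A functional language compiled to WHILE programs *)

Definition poly_bounded (g : nat -> nat) : Prop :=
  exists c k, forall x, (g x <= c * x.+1 ^ k)%N.

Lemma poly_bounded_const a : poly_bounded (fun=> a).
Proof. by exists a, 0%N => x; rewrite expn0 muln1. Qed.

Lemma poly_bounded_id : poly_bounded id.
Proof. by exists 1%N, 1%N => x; rewrite expn1 mul1n. Qed.

Lemma poly_bounded_add g h :
  poly_bounded g -> poly_bounded h -> poly_bounded (fun x => g x + h x)%N.
Proof.
move=> [c [k Hg]] [d [l Hh]]; exists (c + d)%N, (k + l)%N => x.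
rewrite mulnDl; apply: leq_add.
  by apply: leq_trans (Hg x) _; rewrite leq_mul2l leq_pexp2l ?leq_addr ?orbT.
by apply: leq_trans (Hh x) _; rewrite leq_mul2l leq_pexp2l ?leq_addl ?orbT.
Qed.

Lemma poly_bounded_mul g h :
  poly_bounded g -> poly_bounded h -> poly_bounded (fun x => g x * h x)%N.
Proof.
move=> [c [k Hg]] [d [l Hh]]; exists (c * d)%N, (k + l)%N => x.
by rewrite expnD mulnACA leq_mul.
Qed.

Fixpoint shift (D : nat) (a : expr) : expr :=
  match a with
  | Var x => Var (D + x)
  | Nil_ => Nil_
  | Cons a b => Cons (shift D a) (shift D b)
  | Hd a => Hd (shift D a)
  | Tl a => Tl (shift D a)
  | Zero => Zero
  | One => One
  | Add a b => Add (shift D a) (shift D b)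
  | Sub a b => Sub (shift D a) (shift D b)
  | Mul a b => Mul (shift D a) (shift D b)
  | Div a b => Div (shift D a) (shift D b)
  | Le a b => Le (shift D a) (shift D b)
  end.

Fixpoint expr_vars (a : expr) : nat :=
  match a with
  | Var x => x.+1
  | Nil_ | Zero | One => 0
  | Hd a | Tl a => expr_vars a
  | Cons a b | Add a b | Sub a b | Mul a b | Div a b | Le a b =>
      maxn (expr_vars a) (expr_vars b)
  end.

Fixpoint prog_vars (c : prog) : nat :=
  match c with
  | Skip => 0
  | Assign x a => maxn x.+1 (expr_vars a)
  | Query x a b => maxn x.+1 (maxn (expr_vars a) (expr_vars b))
  | Seq c c' => maxn (prog_vars c) (prog_vars c')
  | If a c c' => maxn (expr_vars a) (maxn (prog_vars c) (prog_vars c'))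
  | While a c => maxn (expr_vars a) (prog_vars c)
  end.

Section Language.

Variable R : realType.
Local Notation data := (data R).
Local Notation store := (store R).
Implicit Types (s : store) (o : data -> data -> data).

Lemma eval_shift D N s s' a :
  (expr_vars a <= N)%N ->
  (forall x, (x < N)%N -> s' (D + x)%N = s x) -> eval s' (shift D a) = eval s a.
Proof.
move=> + Hs; elim: a => /=.
  by move=> x; apply: Hs.
all: do ?[move=> a IHa b IHb; rewrite geq_max => /andP[/IHa -> /IHb ->] //].
all: by do ?[move=> a IHa /IHa ->].
Qed.

Lemma shift0 a : shift 0 a = a.
Proof. by elim: a => //= *; congruence. Qed.

Lemma eval_agree N s s' a :
  (expr_vars a <= N)%N ->
  (forall x, (x < N)%N -> s' x = s x) -> eval s' a = eval s a.
Proof. by move=> Ha Hs; rewrite -{1}(shift0 a); apply: eval_shift Ha _. Qed.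

(** The time bound and the correct output of a program are asserted by separate existential
    statements; determinism shows that they concern the same run. *)
Lemma exec_det o c s t s' t1 s1 :
  exec o c s t s' -> exec o c s t1 s1 -> t = t1 /\ s' = s1.
Proof.
move=> H; elim: H t1 s1 => {c s t s'} *.
all: match goal with H : exec _ _ _ _ _ |- _ => inversion H end; subst.
all: repeat match goal with
    IH : forall t1 s1, exec _ ?c ?s t1 s1 -> _, H : exec _ ?c ?s _ _ |- _ =>
      case: (IH _ _ H) => ? ?; subst; clear IH
  end.
all: try by [].
all: match goal with H : is_true ?b, H' : is_true (~~ ?b) |- _ => by rewrite H
  in H' end.
Qed.

Lemma update_eq s x d : update s x d x = d.
Proof. by rewrite /update eqxx. Qed.

Lemma update_neq s x d y : y != x -> update s x d y = s y.
Proof. by rewrite /update => /negbTE ->. Qed.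

Fixpoint spine (d : data) : seq data :=
  if d is Node e d' then e :: spine d' else [::].

Lemma spineK : cancel (@enc_seq R) spine.
Proof. by elim=> //= d l ->. Qed.

(** [FFold r x y a b] loops over the bidders ([r = false]) or the items ([r = true]), with index [x]
    and accumulator [y], started at [a]. [FCall] is one run of a subroutine that stays abstract
    here. *)
Inductive fexp : Type :=
| FPure (a : expr)
| FCons (a b : fexp)
| FIf (a b c : fexp)
| FLet (x : nat) (a b : fexp)
| FFold (r : bool) (x y : nat) (a b : fexp)
| FQuery (a : fexp)
| FCall (a : fexp).

Definition rvar (r : bool) : nat := if r then 4 else 3.

Section Meaning.

Variables (o : data -> data -> data) (callsem : data -> data).

Fixpoint sem (e : fexp) (s : store) : data :=
  match e with
  | FPure a => eval s a
  | FCons a b => Node (sem a s) (sem b s)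
  | FIf a b c => if truth (sem a s) then sem b s else sem c s
  | FLet x a b => sem b (update s x (sem a s))
  | FFold r x y a b =>
      foldl (fun acc z => sem b (update (update s x z) y acc)) (sem a s)
        (spine (s (rvar r)))
  | FQuery a => let d := sem a s in o (data_head d) (data_tail d)
  | FCall a => callsem (sem a s)
  end.

End Meaning.

Section Compiler.

Variable call : nat -> prog.

Definition seqs (l : seq prog) : prog := foldr Seq Skip l.

(** [d] acts as a stack pointer: the result goes to variable [d], temporaries lie above it, and
    variables bound by [FLet] and [FFold] are saved there and restored, so that everything below [d]
    ends unchanged. *)
Fixpoint compile (e : fexp) (d : nat) : prog :=
  match e with
  | FPure a => Assign d a
  | FCons a b =>
      seqs [:: compile a d; compile b d.+1;
               Assign d (Cons (Var d) (Var d.+1))]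
  | FIf a b c => Seq (compile a d) (If (Var d) (compile b d) (compile c d))
  | FLet x a b =>
      seqs [:: compile a d; Assign d.+1 (Var x); Assign x (Var d);
               compile b d.+2; Assign x (Var d.+1); Assign d (Var d.+2)]
  | FFold r x y a b =>
      seqs [:: compile a d; Assign d.+1 (Var (rvar r));
               Assign d.+2 (Var x); Assign d.+3 (Var y);
               While (Var d.+1)
                 (seqs [:: Assign x (Hd (Var d.+1));
                           Assign d.+1 (Tl (Var d.+1));
                           Assign y (Var d);
                           compile b d.+4;
                           Assign d (Var d.+4)]);
               Assign x (Var d.+2); Assign y (Var d.+3)]
  | FQuery a => Seq (compile a d) (Query d (Hd (Var d)) (Tl (Var d)))
  | FCall a => Seq (compile a d) (call d)
  end.

(* Variables 0 to 4 are read only: the loop ranges are found in 3 and 4. *)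
Fixpoint wf (K : nat) (e : fexp) : bool :=
  match e with
  | FPure a => (expr_vars a <= K)%N
  | FCons a b => wf K a && wf K b
  | FIf a b c => [&& wf K a, wf K b & wf K c]
  | FLet x a b => [&& (4 < x < K)%N, wf K a & wf K b]
  | FFold r x y a b =>
      [&& (4 < x < K)%N, (4 < y < K)%N, x != y, wf K a & wf K b]
  | FQuery a | FCall a => wf K a
  end.

(* [L] bounds the lengths of the ranges, [T] the cost of a call. *)
Fixpoint cost (e : fexp) (L T : nat) : nat :=
  match e with
  | FPure a => 1
  | FCons a b => cost a L T + cost b L T + 2
  | FIf a b c => cost a L T + cost b L T + cost c L T + 1
  | FLet x a b => cost a L T + cost b L T + 5
  | FFold r x y a b => cost a L T + L * (cost b L T + 6) + 7
  | FQuery a => cost a L T + 1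
  | FCall a => cost a L T + T
  end.

Lemma poly_bounded_cost e T :
  poly_bounded T -> poly_bounded (fun L => cost e L (T L)).
Proof.
move=> polyT; elim: e => /=.
all: by repeat first [ move=> ? | exact: poly_bounded_const | assumption
  | exact: poly_bounded_id
  | apply: poly_bounded_add | apply: poly_bounded_mul].
Qed.


(** * Correctness of the compiler *)

Section Correctness.

Variables (o : data -> data -> data) (callsem : data -> data).
Variables (n m L T K : nat).
Hypotheses (le_nL : (n <= L)%N) (le_mL : (m <= L)%N).

Definition enc_range (k : nat) : data :=
  enc_seq [seq enc_nat R i | i <- iota 0 k].

Definition ranges s : Prop :=
  [/\ s 1%N = enc_nat R n, s 2%N = enc_nat R m, s 3%N = enc_range n
    & s 4%N = enc_range m].

Lemma ranges_update s x d : (4 < x)%N -> ranges s -> ranges (update s x d).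
Proof. by rewrite /ranges /update; case: x => [|[|[|[|[|x]]]]]. Qed.

Lemma ranges_agree s s' : (4 < K)%N ->
  (forall y, (y < K)%N -> s' y = s y) -> ranges s -> ranges s'.
Proof.
by move=> K4 E; rewrite /ranges !E //; apply: leq_trans K4.
Qed.

Hypothesis callP : forall d s, (K <= d)%N -> ranges s ->
  exists t s', [/\ exec o (call d) s t s', (t <= T)%N,
    s' d = callsem (s d) & forall y, (y < d)%N -> s' y = s y].

Definition computes (e : fexp) (c : prog) (env : store) (d : nat) (C : nat) s :=
  exists t s', [/\ exec o c s t s', (t <= C)%N,
     s' d = sem o callsem e env & forall y, (y < d)%N -> s' y = s y].

(** The source meaning refers to [env], the machine to [s]; they have to agree below [K] only, as
    temporaries lie above. Preservation of everything below [d] re-establishes this agreement after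
    each subexpression. *)
Lemma compileP e : (4 < K)%N -> wf K e -> forall d env s, (K <= d)%N ->
  ranges env -> (forall y, (y < K)%N -> s y = env y) ->
  computes e (compile e d) env d (cost e L T) s.
Proof.
move=> K4; rewrite /computes; elim: e => /=.
- move=> a wfa d env s leKd rg E; exists 1%N, (update s d (eval s a));
  split=> //.
  + exact: ExecAssign.
  + by rewrite update_eq /= (eval_agree wfa E).
  + by move=> y lt; rewrite update_neq // ltn_eqF.
- move=> a IHa b IHb /andP[wfa wfb] d env s leKd rg E.
  have [t1 [s1 [X1 T1 V1 F1]]] := IHa wfa d env s leKd rg E.
  have [|t2 [s2 [X2 T2 V2 F2]]] := IHb wfb d.+1 env s1 (leqW leKd) rg.
    by move=> y lt; rewrite F1 ?E //; apply: leq_trans leKd.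
  exists (t1 + (t2 + (1 + 1)))%N, (update s2 d (Node (s2 d) (s2 d.+1))).
  split; last 1 first.
  + move=> y lt; rewrite update_neq ?ltn_eqF // F2; last lia. by rewrite F1.
  + do 3!(apply: ExecSeq; first by [eassumption | exact: ExecAssign]).
    exact: ExecSkip.
  + lia.
  + by rewrite update_eq V2 F2 // V1.
- move=> a IHa b IHb c IHc /and3P[wfa wfb wfc] d env s leKd rg E.
  have [t1 [s1 [X1 T1 V1 F1]]] := IHa wfa d env s leKd rg E.
  have E1 y : (y < K)%N -> s1 y = env y.
    by move=> lt; rewrite F1 ?E //; apply: leq_trans leKd.
  case: ifPn => cond.
    have [t2 [s2 [X2 T2 V2 F2]]] := IHb wfb d env s1 leKd rg E1.
    exists (t1 + t2.+1)%N, s2; split=> //; last 1 first.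
    + by move=> y lt; rewrite F2 ?F1.
    + by apply: ExecSeq X1 _; apply: ExecIfTrue => //=; rewrite V1.
    + lia.
  have [t2 [s2 [X2 T2 V2 F2]]] := IHc wfc d env s1 leKd rg E1.
  exists (t1 + t2.+1)%N, s2; split=> //; last 1 first.
  + by move=> y lt; rewrite F2 ?F1.
  + by apply: ExecSeq X1 _; apply: ExecIfFalse => //=; rewrite V1.
  + lia.
- move=> x a IHa b IHb /and3P[/andP[x4 xK] wfa wfb] d env s leKd rg E.
  have xd : (x < d)%N by apply: leq_trans leKd.
  have [t1 [s1 [X1 T1 V1 F1]]] := IHa wfa d env s leKd rg E.
  set s2 := update s1 d.+1 (s1 x); set s3 := update s2 x (s1 d).
  have leKd2 : (K <= d.+2)%N by lia.
  have [|t4 [s4 [X4 T4 V4 F4]]] :=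
    IHb wfb d.+2 (update env x (sem o callsem a env)) s3
    leKd2 (ranges_update _ x4 rg).
    move=> y lt; rewrite /s3 /s2 {1 3}/update; case: eqP => // _.
    rewrite update_neq; last lia.
    by rewrite F1 ?E //; lia.
  have X : s2 d = s1 d by rewrite /s2 update_neq //; lia.
  exists (t1 + (1 + (1 + (t4 + (1 + (1 + 1))))))%N,
    (update (update s4 x (s4 d.+1)) d (update s4 x (s4 d.+1) d.+2)).
  split; last 1 first.
  + move=> y lt; rewrite update_neq ?ltn_eqF // {1}/update;
    case: eqP => [->|/eqP ne].
      rewrite F4 // /s3 update_neq; last lia.
      by rewrite /s2 update_eq F1.
    rewrite F4; last lia.
    rewrite /s3 update_neq // /s2 update_neq; last lia.
    by rewrite F1.
  + apply: ExecSeq X1 _; apply: ExecSeq; first exact: ExecAssign.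
    apply: ExecSeq; first exact: ExecAssign.
    rewrite /= -/s2 X -/s3.
    apply: ExecSeq X4 _; apply: ExecSeq; first exact: ExecAssign.
    apply: ExecSeq; first exact: ExecAssign.
    exact: ExecSkip.
  + lia.
  + rewrite update_eq update_neq ?V4 //; lia.
- move=> r x y a IHa b IHb /and5P[/andP[x4 xK] /andP[y4 yK] nexy wfa wfb] d env
  s leKd rg E.
  have xd : (x < d)%N by apply: leq_trans leKd.
  have yd : (y < d)%N by apply: leq_trans leKd.
  have [t1 [s1 [X1 T1 V1 F1]]] := IHa wfa d env s leKd rg E.
  set s2 := update s1 d.+1 (s1 (rvar r)).
  set s3 := update s2 d.+2 (s2 x).
  set s4 := update s3 d.+3 (s3 y).
  have rd : (rvar r < d)%N by rewrite /rvar; case: (r); lia.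
  have [l El lel] : exists2 l, s1 (rvar r) = enc_seq l & (size l <= L)%N.
    case: rg => _ _ rg3 rg4.
    exists [seq enc_nat R i | i <- iota 0 (if r then m else n)].
      by rewrite F1 ?E //; [case: (r) | case: (r) => /=; lia].
    by rewrite size_map size_iota; case: (r).
  have Er : env (rvar r) = enc_seq l.
    by rewrite -El F1 ?E //; case: (r) => /=; lia.
  rewrite Er spineK.
  set body := (X in While _ X).
  (* Loop invariant: [d.+1] holds the remaining range and [d] the accumulator. Agreement with [env]
     is required away from [x] and [y] only, as each round overwrites these two. *)
  have loop (k : seq data) : forall acc s0,
      s0 d.+1 = enc_seq k -> s0 d = acc ->
      (forall z, (z < K)%N -> z != x -> z != y -> s0 z = env z) ->
      exists t s', [/\ exec o (While (Var d.+1) body) s0 t s',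
        (t <= size k * (cost b L T + 6) + 1)%N,
        s' d = foldl (fun acc z => sem o callsem b (update (update env x z) y
          acc)) acc k
        & forall z, (z < d.+4)%N -> z != x -> z != y -> z != d -> z != d.+1 ->
          s' z = s0 z].
    elim: k => [|z k IHk] acc s0 Ek Eacc Ev.
      exists 1%N, s0; split=> //.
      by apply: ExecWhileFalse; rewrite /= Ek.
    set s5 := update s0 x z.
    set s6 := update s5 d.+1 (enc_seq k).
    set s7 := update s6 y acc.
    have [|||t8 [s8 [X8 T8 V8 F8]]] :=
      IHb wfb d.+4 (update (update env x z) y acc) s7.
    - lia.
    - by do 2!apply: ranges_update => //.
    - move=> w lt; rewrite /s7 {1 2}/update; case: eqP => // /eqP ny.
      rewrite /s6 update_neq; last lia.
      rewrite /s5 /update; case: eqP => // /eqP nx.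
      by rewrite Ev.
    set s9 := update s8 d (s8 d.+4).
    have [|||t10 [s10 [X10 T10 V10 F10]]] := IHk (s9 d) s9.
    - rewrite /s9 update_neq; last lia.
      rewrite F8 //; last lia.
      rewrite /s7 update_neq; last lia.
      by rewrite /s6 update_eq.
    - by [].
    - move=> w lt nx ny; rewrite /s9 update_neq; last lia.
      rewrite F8; last lia.
      rewrite /s7 update_neq // /s6 update_neq; last lia.
      by rewrite /s5 update_neq // Ev.
    exists ((1 + (1 + (1 + (t8 + (1 + 1)))) + t10)).+1%N, s10; split=> //.
    + apply: ExecWhileTrue X10; first by rewrite /= Ek.
      have E5 : update s0 x (eval s0 (Hd (Var d.+1))) = s5 by rewrite /= Ek.
      apply: ExecSeq; first exact: ExecAssign.
      rewrite E5; apply: ExecSeq; first exact: ExecAssign.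
      have -> : update s5 d.+1 (eval s5 (Tl (Var d.+1))) = s6.
        by rewrite /s6 /= {2}/s5 update_neq ?Ek //; lia.
      apply: ExecSeq; first exact: ExecAssign.
      have -> : update s6 y (eval s6 (Var d)) = s7.
        rewrite /= /s6 (@update_neq _ _ _ d); last lia.
        rewrite /s5 (@update_neq _ _ _ d) ?Eacc //; lia.
      apply: ExecSeq X8 _.
      apply: ExecSeq; first exact: ExecAssign.
      exact: ExecSkip.
    + rewrite /= mulSn; lia.
    + by rewrite V10 /s9 update_eq V8.
    + move=> w lt nx ny nd nd1; rewrite F10 // /s9 update_neq // F8 //.
      by rewrite /s7 update_neq // /s6 update_neq // /s5 update_neq.
  have [|||t5 [s5 [X5 T5 V5 F5]]] := loop l (sem o callsem a env) s4.
  + rewrite /s4 update_neq; last lia.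
    rewrite /s3 update_neq; last lia.
    by rewrite /s2 update_eq.
  + rewrite /s4 update_neq; last lia.
    rewrite /s3 update_neq; last lia.
    by rewrite /s2 update_neq //; lia.
  + move=> z lt nx ny; rewrite /s4 update_neq; last lia.
    rewrite /s3 update_neq; last lia.
    rewrite /s2 update_neq; last lia.
    by rewrite F1 ?E //; lia.
  exists (t1 + (1 + (1 + (1 + (t5 + (1 + (1 + 1)))))))%N,
    (update (update s5 x (s5 d.+2)) y (update s5 x (s5 d.+2) d.+3)).
  split; last 1 first.
  + move=> z lt; rewrite {1}/update; case: eqP => [->|/eqP ny].
      rewrite update_neq; last lia.
      rewrite F5; try lia.
      rewrite /s4 update_eq /s3 update_neq; last lia.
      by rewrite /s2 update_neq ?F1 //; lia.
    rewrite /update; case: eqP => [->|/eqP nx].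
      rewrite F5; try lia.
      rewrite /s4 update_neq; last lia.
      rewrite /s3 update_eq /s2 update_neq ?F1 //; lia.
    rewrite F5; try lia.
    rewrite /s4 update_neq; last lia.
    rewrite /s3 update_neq; last lia.
    by rewrite /s2 update_neq ?F1 //; lia.
  + apply: ExecSeq X1 _.
    do 3!(apply: ExecSeq; first exact: ExecAssign).
    apply: ExecSeq X5 _.
    do 2!(apply: ExecSeq; first exact: ExecAssign).
    exact: ExecSkip.
  + have : (size l * (cost b L T + 6) <= L * (cost b L T + 6))%N by rewrite
    leq_mul2r lel orbT.
    lia.
  + rewrite update_neq; last lia.
    by rewrite update_neq ?V5 //; lia.
- move=> a IHa wfa d env s leKd rg E.
  have [t1 [s1 [X1 T1 V1 F1]]] := IHa wfa d env s leKd rg E.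
  exists (t1 + 1)%N, (update s1 d (o (data_head (s1 d)) (data_tail (s1 d)))).
  split; last 1 first.
  + by move=> y lt; rewrite update_neq ?F1 // ltn_eqF.
  + by apply: ExecSeq X1 _; apply: ExecQuery.
  + lia.
  + by rewrite update_eq V1.
- move=> a IHa wfa d env s leKd rg E.
  have [t1 [s1 [X1 T1 V1 F1]]] := IHa wfa d env s leKd rg E.
  have [|t2 [s2 [X2 T2 V2 F2]]] := callP leKd (s := s1).
    apply: ranges_agree rg => // y lt.
    by rewrite F1 ?E //; apply: leq_trans leKd.
  exists (t1 + t2)%N, s2; split; last 1 first.
  + by move=> y lt; rewrite F2 ?F1.
  + exact: ExecSeq X1 X2.
  + lia.
  + by rewrite V2 V1.
Qed.

End Correctness.

End Compiler.

End Language.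

(** * Derived constructs *)

Definition FVar x := FPure (Var x).
Definition FNil := FPure Nil_.
Definition FTrue := FPure (Cons Nil_ Nil_).
Definition FZero := FPure Zero.
Definition FOne := FPure One.
Definition FBool a := FIf a FTrue FNil.
Definition FNot a := FIf a FNil FTrue.
Definition FAnd a b := FIf a b FNil.
Definition FOr a b := FIf a FTrue b.

(** The range [r] only supplies enough rounds; variable 52 pairs the counter with the remaining
    list. Comparing the counter with itself detects an atom, which [dec_nat] reads as 0. *)
Definition FDrop r a b :=
  FLet 50
    (FFold r 51 52 (FCons b a)
      (FIf (FPure (Le (Hd (Var 52)) (Hd (Var 52)))) (FVar 52)
        (FIf (FPure (Hd (Var 52)))
          (FPure (Cons (Tl (Hd (Var 52))) (Tl (Tl (Var 52)))))
          (FVar 52))))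
    (FPure (Tl (Var 50))).

Definition FNth r a b := FLet 50 (FDrop r a b) (FPure (Hd (Var 50))).

(** Removing [a] cells from the unary number [b] leaves a nonempty list exactly when [a < b]. *)
Definition FLt r a b := FDrop r b a.

Definition FEq r a b := FAnd (FNot (FLt r a b)) (FNot (FLt r b a)).

(** The first fold collects the values in reverse order; the second uses the same range as a counter
    to move them one by one onto another list, which reverses them again. *)
Definition FMap r x y b :=
  FLet 53 (FFold r x y FNil (FCons b (FVar y)))
    (FLet 53
      (FFold r 54 55 (FPure (Cons (Var 53) Nil_))
        (FPure (Cons (Tl (Hd (Var 55)))
                     (Cons (Hd (Hd (Var 55))) (Tl (Var 55))))))
      (FPure (Tl (Var 53)))).

Definition FSum r x y b :=
  FFold r x y FZero (FLet 53 b (FPure (Add (Var y) (Var 53)))).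

Definition FAny r x y b := FFold r x y FNil (FIf b FTrue (FVar y)).

(* Variable 20 holds the graph, 22 the pair of the remaining vertices and the
   order found so far, 34 the colour classes, 39 the vertex to be coloured, and
   40 the classes free for it. *)
Definition FPeelKey r :=
  FIf (FNth r (FPure (Hd (Var 22))) (FVar 27))
    (FSum r 30 31
      (FIf (FAnd (FNth r (FPure (Hd (Var 22))) (FVar 30))
                 (FNot (FNth r (FNth r (FVar 20) (FVar 30)) (FVar 27))))
        FOne FZero))
    FZero.

Definition FPeelVertex r :=
  FLet 26
    (FFold r 27 28 (FPure (Cons Nil_ Zero))
      (FLet 29 (FPeelKey r)
        (FIf (FPure (Le (Tl (Var 28)) (Var 29)))
          (FPure (Cons (Var 27) (Var 29)))
          (FVar 28))))
    (FPure (Hd (Var 26))).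

Definition FPeel r :=
  FLet 22
    (FFold r 21 22 (FCons (FMap r 23 24 FTrue) FNil)
      (FLet 25 (FPeelVertex r)
        (FCons
          (FMap r 23 24
            (FBool (FAnd (FNth r (FPure (Hd (Var 22))) (FVar 23))
                         (FNot (FEq r (FVar 23) (FVar 25))))))
          (FPure (Cons (Var 25) (Tl (Var 22)))))))
    (FPure (Tl (Var 22))).

Definition FFree r :=
  FMap r 35 36
    (FBool (FNot (FAny r 37 38
      (FAnd (FNth r (FNth r (FVar 34) (FVar 35)) (FVar 37))
            (FOr (FNth r (FNth r (FVar 20) (FVar 39)) (FVar 37))
                 (FNth r (FNth r (FVar 20) (FVar 37)) (FVar 39))))))).

Definition FFirstFit r :=
  FMap r 35 36 (FMap r 37 38
    (FBool (FOr (FNth r (FNth r (FVar 34) (FVar 35)) (FVar 37))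
      (FAnd (FEq r (FVar 37) (FVar 39))
        (FAnd (FNth r (FVar 40) (FVar 35))
          (FNot (FAny r 41 42
            (FAnd (FLt r (FVar 41) (FVar 35))
                  (FNth r (FVar 40) (FVar 41)))))))))).

Definition FColour r :=
  FLet 32 (FPeel r)
    (FFold r 33 34 (FMap r 35 36 (FMap r 37 38 FNil))
      (FLet 39 (FNth r (FVar 32) (FVar 33))
        (FLet 40 (FFree r) (FFirstFit r)))).

(** * The colouring as a function on finite graphs *)

Section Argmax.

Variables (R : realType) (T : Type).

Definition keep_best (key : T -> R) (acc : T * R) (i : T) : T * R :=
  if acc.2 <= key i then (i, key i) else acc.

End Argmax.

Section Colouring.

Variable R : realType.
Variables (k : nat) (x0 : 'I_k) (E : rel 'I_k).

(* Maximizing the number of non-in-neighbours minimizes the in-degree, and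
   makes the key of a remaining vertex positive. *)
Definition peel_key (rem : {set 'I_k}) (i : 'I_k) : R :=
  if i \in rem then
    \sum_(j < k) (if (j \in rem) && ~~ E j i then 1 else 0) else 0.

Definition peel_pick (rem : {set 'I_k}) : 'I_k :=
  (foldl (keep_best (peel_key rem)) (x0, 0) (enum 'I_k)).1.

Definition peel_step (st : {set 'I_k} * seq 'I_k) : {set 'I_k} * seq 'I_k :=
  let v := peel_pick st.1 in (st.1 :\ v, v :: st.2).

(** Vertices are put in front as they are peeled, so the list is already in the order of colouring,
    the vertex peeled last coming first. The loop index merely counts rounds. *)
Definition peel_order : seq 'I_k :=
  (foldl (fun st (_ : 'I_k) => peel_step st) (setT, [::]) (enum 'I_k)).2.

Definition free_classes (cls : bundles k k) (v : 'I_k) : {set 'I_k} :=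
  [set t | ~~ [exists u, (u \in cls t) && (E v u || E u v)]].

Definition first_fit (cls : bundles k k) (v : 'I_k) : bundles k k :=
  let F := free_classes cls v in
  [ffun t => [set u | (u \in cls t) ||
     [&& u == v, t \in F & ~~ [exists t' : 'I_k, (t' < t)%N && (t' \in F)]]]].

(** Classes are indexed by ['I_k], so that the program can loop over them with the range of the
    vertices; classes left over stay empty. *)
Definition colour_classes : bundles k k :=
  foldl first_fit [ffun=> set0] peel_order.

End Colouring.

(** * Meaning of the derived constructs *)

Section Semantics.

Variable R : realType.
Local Notation data := (data R).
Local Notation store := (store R).
Variables (o : data -> data -> data) (callsem : data -> data) (n m : nat).
Local Notation sem := (sem o callsem).
Local Notation ranges := (@ranges R n m).
Implicit Types (s : store) (a b : fexp).

Definition rsize (r : bool) : nat := if r then m else n.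

Lemma truth_enc_bool c : truth (enc_bool R c) = c.
Proof. by case: c. Qed.

(** Carries a loop on mathematical objects over to the loop on their codes, with [h] the
    encoding. *)
Lemma foldl_morph (S T I : Type) (h : S -> T) (f : S -> I -> S)
    (g : T -> I -> T) x l :
  (forall y i, g (h y) i = h (f y i)) ->
  foldl g (h x) l = h (foldl f x l).
Proof. by move=> H; elim: l x => //= i l IH x; rewrite H IH. Qed.

Lemma sem_fold r x y a b s : ranges s ->
  sem (FFold r x y a b) s =
  foldl (fun acc (i : 'I_(rsize r)) =>
     sem b (update (update s x (enc_nat R i)) y acc)) (sem a s)
     (enum 'I_(rsize r)).
Proof.
move=> rg /=; have -> : s (rvar r) = enc_range R (rsize r).
  by case: rg => _ _; case: (r).
rewrite spineK -val_enum_ord -map_comp.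
by elim: (enum _) (sem a s) => //= i l IH z; rewrite IH.
Qed.

Lemma foldl_const_step (S I : Type) (f : S -> S) x (l : seq I) :
  foldl (fun y _ => f y) x l = iter (size l) f x.
Proof. by elim: l x => //= i l IH x; rewrite IH -iterSr. Qed.

Definition drop_step (d : data) : data :=
  if data_head d is Node _ i then Node i (data_tail (data_tail d)) else d.

(** Once the counter is used up, [drop_step] is idle, so surplus rounds do no harm. *)
Lemma iter_drop_step j i l : (dec_nat i <= j)%N ->
  data_tail (iter j drop_step (Node i l)) = iter (dec_nat i) (@data_tail R) l.
Proof.
elim: j i l => [|j IH] i l; first by case: i.
rewrite iterSr; case: i => [|x|e i] /= le_ij.
- have -> : drop_step (Node Leaf l) = Node Leaf l by [].
  by rewrite IH.
- have -> : drop_step (Node (Atom x) l) = Node (Atom x) l by [].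
  by rewrite IH.
have -> : drop_step (Node (Node e i) l) = Node i (data_tail l) by [].
by rewrite IH // -iterSr.
Qed.

Lemma sem_drop r a b s : ranges s -> (dec_nat (sem b s) <= rsize r)%N ->
  sem (FDrop r a b) s = iter (dec_nat (sem b s)) (@data_tail R) (sem a s).
Proof.
move=> rg le_b; rewrite -(iter_drop_step (sem a s) le_b).
have -> : sem (FDrop r a b) s = data_tail (sem
    (FFold r 51 52 (FCons b a)
      (FIf (FPure (Le (Hd (Var 52)) (Hd (Var 52)))) (FVar 52)
        (FIf (FPure (Hd (Var 52)))
          (FPure (Cons (Tl (Hd (Var 52))) (Tl (Tl (Var 52)))))
          (FVar 52)))) s) by [].
congr data_tail; rewrite sem_fold //.
rewrite -[X in iter X _ _](size_enum_ord (rsize r)) -foldl_const_step.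
rewrite [sem (FCons b a) s]/=.
elim: (enum _) (Node _ _) => //= i l IH d; rewrite -IH; congr foldl.
by rewrite /update /= /drop_step; case: d => //= -[|x|? ?] //= ?; rewrite lexx.
Qed.

Lemma dec_enc_nat i : dec_nat (enc_nat R i) = i.
Proof. by elim: i => //= i ->. Qed.

Lemma sem_nth_head r a b s : ranges s -> (dec_nat (sem b s) <= rsize r)%N ->
  sem (FNth r a b) s =
  data_head (iter (dec_nat (sem b s)) (@data_tail R) (sem a s)).
Proof. by move=> rg le_b; rewrite -(sem_drop _ rg le_b). Qed.

Lemma iter_tail_enc_seq i (l : seq data) :
  iter i (@data_tail R) (enc_seq l) = enc_seq (drop i l).
Proof.
elim: i l => [|i IH] l; first by rewrite drop0.
by rewrite iterSr; case: l => [|d l] /=; rewrite ?(IH [::]) ?IH.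
Qed.

Lemma head_iter_tail i (l : seq data) :
  data_head (iter i (@data_tail R) (enc_seq l)) = nth Leaf l i.
Proof.
by rewrite iter_tail_enc_seq; elim: i l => [|i IH] [|d l] //=.
Qed.

(** Common shape of [enc_set], [enc_bundles] and [enc_rel], so that one lookup lemma and one map
    lemma serve all three. *)
Definition enc_fun j (F : 'I_j -> data) : data :=
  enc_seq [seq F i | i <- enum 'I_j].

Lemma head_iter_tail_enc_fun j (F : 'I_j -> data) (i : 'I_j) :
  data_head (iter i (@data_tail R) (enc_fun F)) = F i.
Proof.
by rewrite head_iter_tail (nth_map i) ?size_enum_ord // nth_ord_enum.
Qed.

Lemma sem_nth r a b s (F : 'I_(rsize r) -> data) (i : 'I_(rsize r)) :
  ranges s -> sem a s = enc_fun F -> sem b s = enc_nat R i ->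
  sem (FNth r a b) s = F i.
Proof.
move=> rg Ea Eb; rewrite sem_nth_head // Eb dec_enc_nat ?(ltnW (ltn_ord i)) //.
by rewrite Ea head_iter_tail_enc_fun.
Qed.

Lemma sem_mem r a b s (A : {set 'I_(rsize r)}) (i : 'I_(rsize r)) :
  ranges s -> sem a s = enc_set R A -> sem b s = enc_nat R i ->
  truth (sem (FNth r a b) s) = (i \in A).
Proof. by move=> rg Ea Eb; rewrite (sem_nth rg Ea Eb) truth_enc_bool. Qed.

Lemma sem_row r j a b s (S : bundles (rsize r) j) (i : 'I_(rsize r)) :
  ranges s -> sem a s = enc_bundles R S -> sem b s = enc_nat R i ->
  sem (FNth r a b) s = enc_set R (S i).
Proof. exact: sem_nth. Qed.

Lemma sem_lt r a b s (i j : 'I_(rsize r)) :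
  ranges s -> sem a s = enc_nat R i -> sem b s = enc_nat R j ->
  truth (sem (FLt r a b) s) = (i < j)%N.
Proof.
move=> rg Ea Eb; rewrite /FLt sem_drop // Ea dec_enc_nat ?(ltnW (ltn_ord i)) //.
rewrite Eb /enc_nat iter_tail_enc_seq drop_nseq -subn_gt0.
by case: (j - i)%N.
Qed.

Lemma sem_if a b c s :
  sem (FIf a b c) s = if truth (sem a s) then sem b s else sem c s.
Proof. by []. Qed.

Lemma sem_let x a b s : sem (FLet x a b) s = sem b (update s x (sem a s)).
Proof. by []. Qed.

Lemma sem_cons a b s : sem (FCons a b) s = Node (sem a s) (sem b s).
Proof. by []. Qed.

Lemma sem_bool a s : sem (FBool a) s = enc_bool R (truth (sem a s)).
Proof. by rewrite /=; case: ifP. Qed.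

Lemma sem_not a s : truth (sem (FNot a) s) = ~~ truth (sem a s).
Proof. by rewrite /=; case: ifP. Qed.

Lemma sem_and a b s :
  truth (sem (FAnd a b) s) = truth (sem a s) && truth (sem b s).
Proof. by rewrite /=; case: ifP. Qed.

Lemma sem_or a b s :
  truth (sem (FOr a b) s) = truth (sem a s) || truth (sem b s).
Proof. by rewrite /=; case: ifP. Qed.

Lemma sem_eq r a b s (i j : 'I_(rsize r)) :
  ranges s -> sem a s = enc_nat R i -> sem b s = enc_nat R j ->
  truth (sem (FEq r a b) s) = (i == j).
Proof.
move=> rg Ea Eb; rewrite sem_and !sem_not (sem_lt rg Ea Eb) (sem_lt rg Eb Ea).
by rewrite -!leqNgt -eqn_leq eq_sym.
Qed.

Lemma sem_any r x y b s (B : 'I_(rsize r) -> bool) : ranges s ->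
  (forall (i : 'I_(rsize r)) acc,
     truth (sem b (update (update s x (enc_nat R i)) y acc)) = B i) ->
  truth (sem (FAny r x y b) s) = [exists i, B i].
Proof.
move=> rg Hb; rewrite sem_fold //.
have -> : [exists i, B i] = has B (enum 'I_(rsize r)).
  apply/existsP/hasP => [[i Bi]|[i _ Bi]]; exists i => //.
  by rewrite mem_enum.
rewrite -[RHS]orFb; have -> : false = truth (sem FNil s) by [].
elim: (enum _) (sem FNil s) => [|i l IH] d; first by rewrite orbF.
rewrite [foldl _ _ _]/= IH /= Hb; case: (B i) => /=; first by rewrite orbT.
by rewrite update_eq.
Qed.

Lemma sem_sum r x y b s (F : 'I_(rsize r) -> R) : ranges s ->
  (4 < y)%N -> y != 53%N ->
  (forall (i : 'I_(rsize r)) acc,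
     sem b (update (update s x (enc_nat R i)) y acc) = Atom (F i)) ->
  sem (FSum r x y b) s = Atom (\sum_i F i).
Proof.
move=> rg y4 y53 Hb; rewrite sem_fold // -big_enum.
rewrite -[\sum_(i <- _) F i]add0r [sem FZero s]/=.
suff H z l : foldl (fun acc (i : 'I_(rsize r)) =>
      sem (FLet 53 b (FPure (Add (Var y) (Var 53))))
        (update (update s x (enc_nat R i)) y acc)) (Atom z) l
    = Atom (z + \sum_(i <- l) F i) by apply: H.
elim: l z => [|i l IH] z /=; first by rewrite big_nil addr0.
rewrite big_cons addrA -IH; congr foldl.
by rewrite update_neq // !update_eq Hb.
Qed.

Lemma sem_map r x y b s (F : 'I_(rsize r) -> data) : ranges s ->
  (forall (i : 'I_(rsize r)) acc, sem b (update (update s x (enc_nat R i)) y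
    acc) = F i) ->
  sem (FMap r x y b) s = enc_fun F.
Proof.
move=> rg Hb.
pose d := sem (FFold r x y FNil (FCons b (FVar y))) s.
have Ed : d = enc_seq (rev [seq F i | i <- enum 'I_(rsize r)]).
  rewrite /d sem_fold //.
  have -> : sem FNil s = enc_seq [::] by [].
  rewrite -[rev _]cats0.
  elim: (enum _) [::] => //= i l IH acc.
  by rewrite Hb update_eq rev_cons cat_rcons -IH.
have -> : sem (FMap r x y b) s = data_tail (sem
   (FFold r 54 55 (FPure (Cons (Var 53) Nil_))
        (FPure (Cons (Tl (Hd (Var 55)))
                     (Cons (Hd (Hd (Var 55))) (Tl (Var 55)))))) (update s 53%N
                       d)).
  by [].
rewrite sem_fold; last exact: ranges_update.
rewrite /= update_eq Ed /enc_fun.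
set l := [seq F i | i <- _].
(* The reversing fold has as many rounds as the list has entries, so it moves them all. *)
have Hs : size (enum 'I_(rsize r)) = size (rev l) by rewrite size_rev /l
  size_map.
rewrite -[in RHS](revK l) -[rev (rev l)]cats0.
have -> : @Leaf R = enc_seq [::] by [].
elim: (enum _) (rev l) [::] Hs => [|i t IH] [|e u] acc //= [Hs].
by rewrite rev_cons cat_rcons -IH.
Qed.

Lemma sem_map_set r x y b s (A : {set 'I_(rsize r)}) : ranges s ->
  (forall (i : 'I_(rsize r)) acc,
     truth (sem b (update (update s x (enc_nat R i)) y acc)) = (i \in A)) ->
  sem (FMap r x y (FBool b)) s = enc_set R A.
Proof. by move=> rg H; apply: sem_map => // i acc; rewrite sem_bool H. Qed.

Lemma sem_map_bundles r x y b s j (S : bundles (rsize r) j) : ranges s ->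
  (forall (i : 'I_(rsize r)) acc,
     sem b (update (update s x (enc_nat R i)) y acc) = enc_set R (S i)) ->
  sem (FMap r x y b) s = enc_bundles R S.
Proof. exact: sem_map. Qed.

End Semantics.

(** * The colouring program *)

Ltac lookup := rewrite /= /update //=.
Ltac range_update := repeat (apply: ranges_update => //).

Section ColouringProgram.

Variable R : realType.
Local Notation data := (data R).
Local Notation store := (store R).
Variables (o : data -> data -> data) (callsem : data -> data) (n m : nat).
Local Notation sem := (sem o callsem).
Local Notation ranges := (@ranges R n m).
Variables (r : bool).
Local Notation k := (rsize n m r).
Variables (x0 : 'I_k) (E : rel 'I_k).
Hypothesis x0E : x0 = 0%N :> nat.

Definition out_neighbours : bundles k k := [ffun i => [set j | E i j]].

Lemma sem_edge a b s (i j : 'I_k) :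
  ranges s -> s 20%N = enc_bundles R out_neighbours ->
  sem a s = enc_nat R i -> sem b s = enc_nat R j ->
  truth (sem (FNth r (FNth r (FVar 20) a) b) s) = E i j.
Proof.
move=> rg E20 Ea Eb; rewrite (sem_mem (A := out_neighbours i) rg _ Eb).
  by rewrite ffunE inE.
exact: sem_row.
Qed.

Definition enc_peel (st : {set 'I_k} * seq 'I_k) : data :=
  Node (enc_set R st.1) (enc_seq [seq enc_nat R i | i : 'I_k <- st.2]).

Lemma sem_peel_key s st (i : 'I_k) :
  ranges s -> s 20%N = enc_bundles R out_neighbours ->
  s 22 = enc_peel st -> s 27 = enc_nat R i ->
  sem (FPeelKey r) s = Atom (peel_key R E st.1 i).
Proof.
move=> rg E20 E22 E27; rewrite /FPeelKey /peel_key.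
rewrite sem_if (sem_mem (A := st.1) (i := i)) //;
  last exact: (congr1 (@data_head R) E22).
case: ifP => // _; apply: sem_sum => // j acc.
set s' := update _ _ _; have rg' : ranges s' by range_update.
rewrite sem_if sem_and sem_not (sem_mem (A := st.1) (i := j)) //; last first.
  exact: (congr1 (@data_head R) E22).
by rewrite (sem_edge (i := j) (j := i)) //; case: ifP.
Qed.

Lemma sem_peel_pick s st :
  ranges s -> s 20%N = enc_bundles R out_neighbours -> s 22 = enc_peel st ->
  sem (FPeelVertex r) s = enc_nat R (peel_pick R x0 E st.1).
Proof.
move=> rg E20 E22; rewrite /FPeelVertex /peel_pick.
pose h (p : 'I_k * R) := Node (enc_nat R p.1) (Atom p.2).
set x := foldl _ _ _.
suff H : sem (FFold r 27 28 (FPure (Cons Nil_ Zero))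
      (FLet 29 (FPeelKey r)
        (FIf (FPure (Le (Tl (Var 28)) (Var 29)))
          (FPure (Cons (Var 27) (Var 29)))
          (FVar 28)))) s = h x.
  exact: (congr1 (@data_head R) H).
rewrite (sem_fold _ _ _ _ _ _ _ rg);
  have -> : sem (FPure (Cons Nil_ Zero)) s = h (x0, 0).
  (* [Nil_] is the unary code of 0, so the default vertex has to be vertex 0. *)
  by rewrite /h /= x0E.
apply: foldl_morph => -[j z] i; rewrite /keep_best.
have H : sem (FPeelKey r) (update (update s 27 (enc_nat R i)) 28 (h (j, z)))
       = Atom (peel_key R E st.1 i).
  by apply: sem_peel_key => //; range_update.
by rewrite sem_let H; lookup; case: (z <= _).
Qed.

Lemma sem_peel s :
  ranges s -> s 20%N = enc_bundles R out_neighbours ->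
  sem (FPeel r) s = enc_seq [seq enc_nat R i | i : 'I_k <- peel_order R x0 E].
Proof.
move=> rg E20; rewrite /FPeel /peel_order.
set x := foldl _ _ _.
suff H : sem (FFold r 21 22 (FCons (FMap r 23 24 FTrue) FNil)
      (FLet 25 (FPeelVertex r)
        (FCons
          (FMap r 23 24
            (FBool (FAnd (FNth r (FPure (Hd (Var 22))) (FVar 23))
                         (FNot (FEq r (FVar 23) (FVar 25))))))
          (FPure (Cons (Var 25) (Tl (Var 22))))))) s = enc_peel x.
  exact: (congr1 (@data_tail R) H).
rewrite (sem_fold _ _ _ _ _ _ _ rg).
have -> : sem (FCons (FMap r 23 24 FTrue) FNil) s = enc_peel (setT, [::]).
  rewrite sem_cons; congr Node.
  by apply: sem_map => // i acc; rewrite inE.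
apply: foldl_morph => st i.
set s1 := update _ _ _; have rg1 : ranges s1 by range_update.
rewrite sem_let sem_cons (@sem_peel_pick s1 st) //; congr Node.
apply: sem_map_set => [|j acc]; first by range_update.
set s2 := update _ _ _; have rg2 : ranges s2 by range_update.
rewrite sem_and sem_not (sem_mem (A := st.1) (i := j)) //.
by rewrite (sem_eq (i := j) (j := peel_pick R x0 E st.1)) // !inE andbC.
Qed.

Lemma sem_free s cls (v : 'I_k) :
  ranges s -> s 20%N = enc_bundles R out_neighbours ->
  s 34 = enc_bundles R cls -> s 39 = enc_nat R v ->
  sem (FFree r) s = enc_set R (free_classes E cls v).
Proof.
move=> rg E20 E34 E39; apply: sem_map_set => // t acc.
set s1 := update _ _ _; have rg1 : ranges s1 by range_update.
rewrite sem_not inE; congr (~~ _); apply: sem_any => // u acc'.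
set s2 := update _ _ _; have rg2 : ranges s2 by range_update.
rewrite sem_and sem_or (sem_edge (i := v) (j := u)) // (sem_edge (i :=
  u) (j := v)) //.
rewrite (sem_mem (A := cls t) (i := u)) //.
exact: (sem_row (S := cls)).
Qed.

Lemma sem_first_fit s cls (v : 'I_k) :
  ranges s -> s 34 = enc_bundles R cls -> s 39 = enc_nat R v ->
  s 40 = enc_set R (free_classes E cls v) ->
  sem (FFirstFit r) s = enc_bundles R (first_fit E cls v).
Proof.
move=> rg E34 E39 E40; apply: sem_map_bundles => // t acc.
apply: sem_map_set => [|u acc']; first by range_update.
set s2 := update _ _ _; have rg2 : ranges s2 by range_update.
rewrite sem_or sem_and (sem_eq (i := u) (j := v)) // sem_and sem_not ffunE inE.
rewrite (sem_mem (A := cls t) (i := u)) //; last first.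
  exact: (sem_row (S := cls)).
rewrite (sem_mem (A := free_classes E cls v) (i := t)) //.
congr (_ || (_ && (_ && ~~ _))); apply: sem_any => // t' acc''.
set s3 := update _ _ _; have rg3 : ranges s3 by range_update.
rewrite sem_and (sem_lt (i := t') (j := t)) //.
by rewrite (sem_mem (A := free_classes E cls v) (i := t')).
Qed.

Lemma foldl_map (S T I : Type) (h : I -> T) (f : S -> T -> S) x l :
  foldl f x [seq h i | i <- l] = foldl (fun y i => f y (h i)) x l.
Proof. by elim: l x => //= i l IH x; rewrite IH. Qed.

Lemma sem_colour s :
  ranges s -> s 20%N = enc_bundles R out_neighbours ->
  sem (FColour r) s = enc_bundles R (colour_classes R x0 E).
Proof.
move=> rg E20; rewrite /FColour /colour_classes sem_let sem_peel //.
set s1 := update _ _ _; have rg1 : ranges s1 by range_update.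
rewrite (sem_fold _ _ _ _ _ _ _ rg1).
have -> : sem (FMap r 35 36 (FMap r 37 38 FNil)) s1
          = enc_bundles R ([ffun=> set0] : bundles k k).
  apply: sem_map_bundles => // t acc.
  set s2 := update _ _ _; have rg2 : ranges s2 by range_update.
  by apply: sem_map => // u acc'; rewrite ffunE inE.
set ord := peel_order _ _ _.
(* The program loops over positions in the list instead of its entries; this is the same because the
   list has length [k], one vertex being added per round. *)
have ordE : ord = [seq nth x0 ord (val i) | i <- enum 'I_k].
  rewrite (map_comp (nth x0 ord)) val_enum_ord.
  suff ord_size : size ord = k by rewrite -[X in iota 0 X]ord_size -/(mkseq _
    _) mkseq_nth.
  rewrite -[RHS](size_enum_ord k) -[RHS]addn0.
  rewrite -[X in (_ + X)%N]/(size (setT : {set 'I_k}, [::] : seq 'I_k).2).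
  rewrite /ord /peel_order.
  by elim: (enum _) (setT, _) => //= i l IH st; rewrite IH addnS.
rewrite [in RHS]ordE foldl_map.
apply: foldl_morph => cls i.
set s2 := update _ _ _; have rg2 : ranges s2 by range_update.
set v := nth x0 ord i.
have Ev : sem (FNth r (FVar 32) (FVar 33)) s2 = enc_nat R v.
  rewrite (sem_nth (F := fun i : 'I_k => enc_nat R (nth x0 ord (val i))) (i :=
    i)) //.
  have -> : sem (FVar 32) s2 = enc_seq [seq enc_nat R i | i : 'I_k <- ord] by
    [].
  by rewrite [in LHS]ordE -map_comp.
rewrite sem_let Ev sem_let (sem_free (cls := cls) (v := v)) //.
by apply: sem_first_fit => //; range_update.
Qed.

End ColouringProgram.

(** * Colourings with at most 2 Delta + 1 classes *)

(** The start pair may survive as the result: the peeling excludes this by a positive key, and for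
    the auctions it stands for the empty allocation. *)
Lemma keep_bestP (R : realType) (T : eqType) (key : T -> R) p0 l :
  let p := foldl (keep_best key) p0 l in
  [/\ forall i, i \in l -> key i <= p.2, p0.2 <= p.2
    & p = p0 \/ p.1 \in l /\ p.2 = key p.1].
Proof.
elim: l p0 => [|i l IH] p0 /=; first by split=> //; left.
have [H1 H2 H3] := IH (keep_best key p0 i).
set p := foldl _ _ _ in H1 H2 H3 *.
have [le_i le_0] : key i <= p.2 /\ p0.2 <= p.2.
  by move: H2; rewrite /keep_best;
    case: (leP p0.2 (key i)) => /= [H|/ltW H] H2; split=> //;
      apply: le_trans H _.
split=> //.
  by move=> j; rewrite inE => /orP[/eqP->|/H1].
case: H3 => [|[H3 H4]]; last by right; rewrite inE H3 orbT.
rewrite /keep_best; case: ifP => _ ->; last by left.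
by right; rewrite inE eqxx.
Qed.

Section ColouringProperties.

Variable R : realType.
Variables (k : nat) (x0 : 'I_k) (E : rel 'I_k).
Hypothesis E_irr : irreflexive E.
Local Notation Delta := (max_outdegree E).
Implicit Types (rem : {set 'I_k}) (u v : 'I_k) (cls : bundles k k).

Lemma outdegree_le u : (#|[set v | E u v]| <= Delta)%N.
Proof. exact: (leq_bigmax (F := fun u : 'I_k => #|[set v | E u v]|)). Qed.

Lemma peel_keyE rem u :
  u \in rem -> peel_key R E rem u = #|[set v in rem | ~~ E v u]|%:R.
Proof.
move=> remu; rewrite /peel_key remu -big_mkcond -sum1_card natr_sum /=.
by apply: eq_bigl => v; rewrite inE.
Qed.

(** Averaging: inside [rem] the in-degrees and the out-degrees have the same sum, which is at most
    [#|rem| * Delta], and the picked vertex has minimum in-degree. *)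
Lemma peel_pickP rem : rem != set0 ->
  peel_pick R x0 E rem \in rem /\
  (#|[set u in rem | E u (peel_pick R x0 E rem)]| <= Delta)%N.
Proof.
move=> rem0; rewrite /peel_pick.
have [H1 H2 H3] := keep_bestP (peel_key R E rem) (x0, 0) (enum 'I_k).
set p := foldl _ _ _ in H1 H2 H3 *.
have [w remw] := set0Pn _ rem0.
(* As there is no loop at [w], this vertex counts itself as a non-in-neighbour, so its key is at
   least 1 and beats the start pair with key 0. *)
have p_gt0 : 0 < p.2.
  apply: lt_le_trans (H1 w (mem_enum _ w)).
  rewrite peel_keyE // ltr0n card_gt0; apply/set0Pn.
  by exists w; rewrite inE remw E_irr.
have Ep : p.2 = peel_key R E rem p.1.
  by case: H3 => [Ep|[]//]; rewrite Ep ltxx in p_gt0.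
have remp : p.1 \in rem.
  by apply: contraLR p_gt0 => H; rewrite Ep /peel_key (negbTE H) ltxx.
split=> //.
pose din u := #|[set v in rem | E v u]|.
have dinE u : (din u + #|[set v in rem | ~~ E v u]| = #|rem|)%N.
  rewrite -(cardsID [set v | E v u] rem); congr addn; apply: eq_card => v.
    by rewrite !inE.
  by rewrite !inE andbC.
have le_din u : u \in rem -> (din p.1 <= din u)%N.
  move=> remu; have := H1 u (mem_enum _ u).
  rewrite Ep !peel_keyE // ler_nat => H.
  by rewrite -(leq_add2r #|[set v in rem | ~~ E v p.1]|) dinE -(dinE u)
    leq_add2l.
have : (#|rem| * din p.1 <= #|rem| * Delta)%N.
  have -> : (#|rem| * din p.1 = \sum_(u in rem) din p.1)%N by rewrite
    sum_nat_const.
  apply: (@leq_trans (\sum_(u in rem) din u)); first exact: leq_sum.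
  (* Double counting of the edges inside [rem], by head and by tail. *)
  have -> : (\sum_(u in rem) din u = \sum_(v in rem) #|[set u in rem | E v
    u]|)%N.
    have H (A : 'I_k -> {set 'I_k}) : (\sum_(u in rem) #|A u| = \sum_(u in rem)
      \sum_v (v \in A u))%N.
      by apply: eq_bigr => u _; rewrite -sum1_card big_mkcond.
    rewrite /din !H exchange_big [RHS]big_mkcond /=; apply: eq_bigr => v _.
    case: ifP => remv; last by apply: big1 => u _; rewrite !inE remv.
    rewrite big_mkcond; apply: eq_bigr => u _; rewrite !inE remv.
    by case: (u \in rem).
  rewrite -sum_nat_const; apply: leq_sum => v _.
  apply: leq_trans (outdegree_le v).
  by apply: subset_leq_card; apply/subsetP => u; rewrite !inE => /andP[].
by rewrite leq_pmul2l // card_gt0.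
Qed.

(** For [v :: s'], the vertices outside [s'] are those present when [v] was peeled; without [v] they
    are also those coloured before [v]. *)
Fixpoint degenerate (s : seq 'I_k) : bool :=
  if s is v :: s' then
    [&& v \notin s', (#|[set u | (u \notin s') && E u v]| <= Delta)%N
      & degenerate s'] else true.

Lemma degenerate_uniq s : degenerate s -> uniq s.
Proof. by elim: s => //= v s IH /and3P[-> _ /IH]. Qed.

Lemma peel_orderP :
  degenerate (peel_order R x0 E) /\ forall u, u \in peel_order R x0 E.
Proof.
have H (l : seq 'I_k) st : st.1 = [set u | u \notin st.2] -> degenerate st.2 ->
    (size l + size st.2 = k)%N ->
    let st' := foldl (fun st _ => peel_step R x0 E st) st l in
    degenerate st'.2 /\ size st'.2 = k.
  elim: l st => //= _ l IH [rem s] /= Erem deg Hs.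
  have remE u : (u \in rem) = (u \notin s) by rewrite Erem inE.
  (* A round is left, so fewer than [k] vertices have been peeled and [rem] is nonempty. *)
  have [|remv degv] := @peel_pickP rem.
    apply/eqP => rem0.
    suff : (k <= size s)%N by lia.
    rewrite -(card_uniqP (degenerate_uniq deg)) -[X in (X <= _)%N]card_ord.
    apply: subset_leq_card.
    apply/subsetP => u _; have := in_set0 u.
    by rewrite -rem0 Erem inE => /negbFE.
  apply: IH => /=.
  - by apply/setP => u; rewrite Erem !inE negb_or.
  - rewrite deg andbT; apply/andP; split; first by rewrite -remE.
    apply: leq_trans degv; apply: subset_leq_card; apply/subsetP => u.
    by rewrite !inE remE.
  - by rewrite addnS.
have [|//||deg Hs] := H (enum 'I_k) (setT, [::]).
- by apply/setP => u; rewrite !inE.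
- by rewrite size_enum_ord addn0.
split=> // u.
have U := degenerate_uniq deg.
have : (#|peel_order R x0 E| = #|'I_k|)%N by rewrite card_ord -[RHS]Hs;
  apply/card_uniqP.
by move/subset_cardP/(_ (subset_predT _)) => ->.
Qed.

(** [s] lists the vertices still to be coloured. *)
Definition partial_colouring cls (s : seq 'I_k) : Prop :=
  [/\ forall u, (u \notin s) = [exists t, u \in cls t],
      forall u t t', u \in cls t -> u \in cls t' -> t = t',
      forall u v t, u \in cls t -> v \in cls t -> ~~ E u v
    & forall u t, u \in cls t -> (t <= Delta.*2)%N].

(** At most [Delta] out-neighbours of [v] and, by degeneracy, at most [Delta] coloured in-neighbours
    block one class each, so the least free class has index at most [Delta.*2]. *)
Lemma first_fitP cls v s : degenerate (v :: s) ->
  partial_colouring cls (v :: s) -> partial_colouring (first_fit E cls v) s.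
Proof.
move=> /= /and3P[vs degv _] [cov tr ind bnd].
set F := free_classes E cls v.
have uF u t : u \in cls t -> u \notin v :: s.
  by move=> ut; rewrite cov; apply/existsP; exists t.
(* The class of a coloured vertex; the default [v] is a dummy for uncoloured ones, which do not
   occur in [N]. *)
pose g u := odflt v [pick t | u \in cls t].
have gE u t : u \in cls t -> g u = t.
  by move=> ut; rewrite /g; case: pickP => [t' /tr|/(_ t)];
    [exact | rewrite ut].
pose N := [set u | (u \notin v :: s) && (E v u || E u v)].
have cardF : (#|~: F| <= #|N|)%N.
  apply: leq_trans (leq_imset_card g _); apply: subset_leq_card.
  apply/subsetP => t; rewrite !inE negbK => /existsP[u /andP[ut adj]].
  apply/imsetP; exists u; last by rewrite (gE u t).
  by rewrite inE (uF u t) // adj.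
have cardN : (#|N| <= Delta.*2)%N.
  apply: (@leq_trans #|[set u | E v u] :|: [set u | (u \notin s) && E u v]|).
    apply: subset_leq_card; apply/subsetP => u; rewrite !inE.
    by case/andP; rewrite negb_or => /andP[_ ->].
  rewrite -addnn; apply: leq_trans (leq_card_setU _ _) _.
  by apply: leq_add degv; apply: outdegree_le.
(* [v] is not in [N], so fewer than [k] classes are blocked. *)
have [t1 Ft1] : exists t, t \in F.
  apply/set0Pn; rewrite -card_gt0 -(ltn_add2r #|~: F|) add0n cardsC card_ord.
  apply: leq_ltn_trans cardF _.
  apply: (@leq_trans #|[set: 'I_k]|); last by rewrite cardsT card_ord.
  by apply: proper_card; apply/properP; split=> //; exists v;
    rewrite !inE ?eqxx.
have [t0 Ft0 t0_min] := arg_minnP (fun t : 'I_k => val t) Ft1.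
have {}Ft0 : t0 \in F := Ft0.
(* By minimality the [t0] classes before [t0] are all blocked. *)
have t0_le : (t0 <= Delta.*2)%N.
  apply: leq_trans cardN; apply: leq_trans cardF.
  pose w := widen_ord (ltnW (ltn_ord t0)).
  have -> : t0 = #|[set w j | j : 'I_t0]| :> nat.
    by rewrite card_imset ?card_ord // => i j /(congr1 val) /= /val_inj.
  apply: subset_leq_card; apply/subsetP => _ /imsetP[j _ ->].
  rewrite inE; apply: contraTN (ltn_ord j) => /t0_min /=.
  by rewrite -leqNgt.
have ffE t u : (u \in first_fit E cls v t) = (u \in cls t) || (u == v) && (t ==
  t0).
  rewrite ffunE inE -/F; congr (_ || (_ && _)); apply/andP/eqP => [[Ft nex]|->].
    apply: val_inj => /=; apply/eqP; rewrite eqn_leq t0_min // andbT leqNgt.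
    by apply: contra nex => lt; apply/existsP; exists t0; rewrite lt.
  split=> //; apply/existsP => -[t' /andP[lt /t0_min]] /=.
  by rewrite leqNgt lt.
have vcls t : v \notin cls t by apply/negP => /uF; rewrite mem_head.
have vfree u : u \in cls t0 -> ~~ E u v && ~~ E v u.
  move=> ut; move: Ft0; rewrite inE negb_exists => /forallP/(_ u).
  by rewrite ut /= negb_or andbC.
split.
- move=> u; have [->|nuv] := eqVneq u v.
    by rewrite vs; apply/esym/existsP; exists t0; rewrite ffE !eqxx orbT.
  have := cov u; rewrite inE (negbTE nuv) /= => ->.
  by apply: eq_existsb => t; rewrite ffE (negbTE nuv) orbF.
- move=> u t t'; rewrite !ffE.
  case: (eqVneq u v) => [->|_]; last by rewrite !orbF; apply: tr.
  by rewrite !(negbTE (vcls _)) /= => /eqP -> /eqP ->.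
- move=> u w t; rewrite !ffE.
  case/orP => [ut|/andP[/eqP-> /eqP->]]; case/orP => [wt|/andP[/eqP-> /eqP Et]].
  + exact: ind ut wt.
  + by rewrite Et in ut; case/andP: (vfree u ut).
  + by case/andP: (vfree w wt).
  + by rewrite E_irr.
- move=> u t; rewrite ffE => /orP[/bnd//|/andP[_ /eqP->]] //.
Qed.

Lemma colour_classesP (cls := colour_classes R x0 E) :
  [/\ forall u, exists t, u \in cls t,
      forall u v t, u \in cls t -> v \in cls t -> ~~ E u v
    & forall u t, u \in cls t -> (t <= Delta.*2)%N].
Proof.
have [deg all] := peel_orderP.
have H s c : degenerate s -> partial_colouring c s ->
    partial_colouring (foldl (first_fit E) c s) [::].
  elim: s c => //= v s IH c degv pc; apply: IH; last exact: first_fitP.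
  by case/and3P: degv.
have [|cov _ ind bnd] := H (peel_order R x0 E) [ffun=> set0] deg.
  split.
  - move=> u; rewrite all /=; apply/esym/existsP => -[t]; rewrite ffunE inE //.
  - by move=> u t t'; rewrite ffunE inE.
  - by move=> u v t; rewrite ffunE inE.
  - by move=> u t; rewrite ffunE inE.
by split=> // u; apply/existsP; rewrite -cov.
Qed.

End ColouringProperties.

(** * Running a program on restricted valuations *)

Definition restrict (R : realType) n m (v : profile R n m) (J : bundles n m) :
    profile R n m :=
  fun i A => v i (A :&: J i).

(** The inputs are first packed into variable 10, so that no loop variable can capture [j], [q] or
    [q.+1]. *)
Definition FRestrictedQuery (j q : nat) : fexp :=
  FLet 10 (FCons (FVar j) (FCons (FVar q) (FVar q.+1)))
    (FQuery (FCons (FPure (Hd (Tl (Var 10))))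
      (FMap true 11 12 (FBool (FAnd
        (FNth true (FPure (Tl (Tl (Var 10)))) (FVar 11))
        (FNth true (FNth false (FPure (Hd (Var 10))) (FPure (Hd (Tl (Var 10)))))
          (FVar 11))))))).

(* [D] is the offset of the variables of the program, [j] the variable holding
   the bundles to which the queries are restricted, and [q] the first free
   variable. *)
Fixpoint restrict_prog (D j q : nat) (c : prog) : prog :=
  match c with
  | Skip => Skip
  | Assign x a => Assign (D + x) (shift D a)
  | Query x a b =>
      seqs [:: Assign q (shift D a); Assign q.+1 (shift D b);
               compile (fun=> Skip) (FRestrictedQuery j q) q.+2;
               Assign (D + x) (Var q.+2)]
  | Seq c c' => Seq (restrict_prog D j q c) (restrict_prog D j q c')
  | If a c c' => If (shift D a) (restrict_prog D j q c) (restrict_prog D j q c')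
  | While a c => While (shift D a) (restrict_prog D j q c)
  end.

(** Variable [d] holds the code of the bundles on entry and the outcome on exit. The block after it
    is cleared first, since [P] expects an empty store apart from its input; the successor in [N]
    makes room for variable 0 in any case. *)
Definition call_prog (P : prog) (d : nat) : prog :=
  let D := d.+1 in let N := (prog_vars P).+1 in
  Seq (seqs [seq Assign (D + x) Nil_ | x <- iota 0 N])
    (seqs [:: Assign D (Cons (Var 1) (Cons (Var 2) Nil_));
              restrict_prog D d (D + N) P; Assign d (Var D)]).

Definition query_cost (L : nat) : nat :=
  (cost (FRestrictedQuery 0 0) L 1 + 5)%N.

(** Each step of [P] is charged as much as a restricted query, the dearest instruction to
    simulate. *)
Definition call_cost (P : prog) (L t : nat) : nat :=
  (prog_vars P + t * query_cost L + 6)%N.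

(** * Simulation of a program on restricted valuations *)

Section Call.

Variable R : realType.
Local Notation data := (data R).
Local Notation store := (store R).
Variables (n m : nat) (v : profile R n m).
Local Notation ranges := (@ranges R n m).
Implicit Types (s : store).

Definition dec_bundles (d : data) : bundles n m :=
  [ffun i : 'I_n => dec_set m (data_head (iter i (@data_tail R) d))].

Lemma enc_setK j : cancel (@enc_set R j) (@dec_set R j).
Proof.
move=> A; apply/setP => i; rewrite inE.
by rewrite (@head_iter_tail_enc_fun R j (fun i => enc_bool R (i \in A)))
  truth_enc_bool.
Qed.

Lemma enc_bundlesK : cancel (@enc_bundles R n m) dec_bundles.
Proof.
move=> S; apply/ffunP => i; rewrite ffunE.
by rewrite (@head_iter_tail_enc_fun R n (fun i => enc_set R (S i))) enc_setK.
Qed.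

Lemma sem_restricted_query callsem j q s : ranges s ->
  sem (value_oracle v) callsem (FRestrictedQuery j q) s =
  value_oracle (restrict v (dec_bundles (s j))) (s q) (s q.+1).
Proof.
move=> rg; rewrite /FRestrictedQuery sem_let.
set s1 := update _ _ _; have rg1 : ranges s1 by range_update.
have -> a : sem (value_oracle v) callsem (FQuery a) s1 =
  value_oracle v (data_head (sem (value_oracle v) callsem a s1))
    (data_tail (sem (value_oracle v) callsem a s1)) by [].
rewrite sem_cons; set M := sem _ _ (FMap _ _ _ _) _.
have -> : data_head (Node (sem (value_oracle v) callsem (FPure (Hd (Tl (Var
  10)))) s1) M)
   = s q by [].
have -> : data_tail (Node (sem (value_oracle v) callsem (FPure (Hd (Tl (Var
  10)))) s1) M)
   = M by [].
(* A program may query with arbitrary data. If the index is not a bidder, both oracles answer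
   [Leaf], so the lookup has to be right for a valid [i] only. *)
rewrite /value_oracle; case: insubP => // i _ Ei.
suff -> : M = enc_set R (dec_set m (s q.+1) :&: dec_bundles (s j) i).
  by rewrite enc_setK.
have Eq : dec_nat (s q) = i by [].
apply: (sem_map_set (n := n) (m := m) (r := true)) => // k acc.
set s2 := update _ _ _; have rg2 : ranges s2 by range_update.
have E11 : sem (value_oracle v) callsem (FVar 11) s2 = enc_nat R k by [].
rewrite sem_and !(sem_nth_head (r := true) _ rg2) ?E11 ?dec_enc_nat;
  try exact: ltnW (ltn_ord k).
rewrite (sem_nth_head (r := false) _ rg2); last first.
  by rewrite -[dec_nat _]/(dec_nat (s q)) Eq (ltnW (ltn_ord i)).
rewrite -[dec_nat (sem _ _ _ _)]/(dec_nat (s q)) Eq.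
by rewrite !inE ffunE inE.
Qed.

Section Simulation.

Variables (J : bundles n m) (L D j N : nat).
Hypotheses (le_nL : (n <= L)%N) (le_mL : (m <= L)%N).
Hypotheses (D60 : (60 < D)%N) (jD : (j < D)%N).
Local Notation q := (D + N)%N.

Definition simulates (s s' : store) : Prop :=
  forall x, (x < N)%N -> s' (D + x)%N = s x.

Lemma simulates_update s s' x d : (x < N)%N -> simulates s s' ->
  simulates (update s x d) (update s' (D + x)%N d).
Proof. by move=> ltx H y lty; rewrite /update eqn_add2l; case: eqP => // _;
  apply: H. Qed.

Lemma query_cost_gt0 : (0 < query_cost L)%N.
Proof. by rewrite /query_cost addnC. Qed.

Lemma ranges_frame s s' : (forall y, (y < D)%N -> s' y = s y) -> ranges s ->
  ranges s'.
Proof. by move=> H; apply: (@ranges_agree R n m D) => //;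
  apply: ltn_trans D60. Qed.

(** Induction on the run. As variables below [D] are preserved, the ranges and the code of [J] in
    [j] stay available to every later query. *)
Lemma restrict_progP c s t s' :
  exec (value_oracle (restrict v J)) c s t s' -> (prog_vars c <= N)%N ->
  forall S, ranges S -> dec_bundles (S j) = J -> simulates s S ->
  exists t' S', [/\ exec (value_oracle v) (restrict_prog D j q c) S t' S',
    (t' <= t * query_cost L)%N, simulates s' S'
    & forall y, (y < D)%N -> S' y = S y].
Proof.
have C0 := query_cost_gt0.
elim => {c s t s'}.
- move=> s _ S rg EJ sim; exists 1%N, S; split=> //; rewrite ?mul1n //.
  exact: ExecSkip.
- move=> s x a /=; rewrite geq_max => /andP[ltx lea] S rg EJ sim.
  exists 1%N, (update S (D + x)%N (eval s a)); split; last 1 first.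
  + by move=> y lt; rewrite update_neq //; lia.
  + by rewrite -(eval_shift lea sim); apply: ExecAssign.
  + by rewrite mul1n.
  + exact: simulates_update.
- move=> s x a b /=; rewrite !geq_max => /and3P[ltx lea leb] S rg EJ sim.
  set S1 := update S q (eval s a).
  have sim1 : simulates s S1.
    by move=> y lt; rewrite /S1 update_neq ?sim // eqn_add2l ltn_eqF.
  set S2 := update S1 q.+1 (eval s b).
  have F2 y : (y < D)%N -> S2 y = S y.
    by move=> lt; rewrite /S2 /S1 !update_neq //; lia.
  have rg2 := ranges_frame F2 rg.
  (* A restricted query contains no call, so [Skip] with the identity fills the place of the
     subroutine. *)
  have [||||||t3 [S3 [X3 T3 V3 F3]]] :=
    @compileP R (fun=> Skip) (value_oracle v) id
      n m L 1 q.+2 le_nL le_mL _ (FRestrictedQuery j q) _ _ q.+2 S2 S2 => //.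
  + move=> d s0 _ _; exists 1%N, s0; split=> //; exact: ExecSkip.
  + by lia.
  + by rewrite /=; lia.
  exists (1 + (1 + (t3 + (1 + 1))))%N, (update S3 (D + x)%N (S3 q.+2)).
  split; last 1 first.
  + move=> y lt; rewrite update_neq; last lia.
    by rewrite F3 ?F2 //; lia.
  + apply: ExecSeq; first exact: ExecAssign.
    rewrite (eval_shift lea sim) -/S1.
    apply: ExecSeq; first exact: ExecAssign.
    rewrite (eval_shift leb sim1) -/S2.
    apply: ExecSeq X3 _; apply: ExecSeq; first exact: ExecAssign.
    exact: ExecSkip.
  + rewrite mul1n /query_cost; move: T3.
    rewrite -[cost (FRestrictedQuery j _) _ _]/(cost (FRestrictedQuery 0 0) L
      1).
    by lia.
  + have -> : S3 q.+2 = value_oracle (restrict v J) (eval s a) (eval s b).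
      rewrite V3 sem_restricted_query // F2 // EJ.
      by rewrite {1}/S2 update_neq ?ltn_eqF // /S1 /S2 !update_eq.
    apply: simulates_update => // y lt; rewrite F3; last lia.
    by rewrite /S2 /S1 !update_neq ?sim //; lia.
- move=> c c' s t s' t' s'' _ IH1 _ IH2 /=; rewrite geq_max => /andP[lec lec'].
  move=> S rg EJ sim.
  have [t1 [S1 [X1 T1 sim1 F1]]] := IH1 lec S rg EJ sim.
  have [|t2 [S2 [X2 T2 sim2 F2]]] := IH2 lec' S1 (ranges_frame F1 rg) _ sim1.
    by rewrite F1.
  exists (t1 + t2)%N, S2; split=> //.
  + exact: ExecSeq X1 X2.
  + by rewrite mulnDl leq_add.
  + by move=> y lt; rewrite F2 ?F1.
- move=> a c c' s t s' cond _ IH /=; rewrite !geq_max => /and3P[lea lec lec'].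
  move=> S rg EJ sim.
  have [t1 [S1 [X1 T1 sim1 F1]]] := IH lec S rg EJ sim.
  exists t1.+1, S1; split=> //.
  + by apply: ExecIfTrue X1; rewrite (eval_shift lea sim).
  + by rewrite mulSn; lia.
- move=> a c c' s t s' cond _ IH /=; rewrite !geq_max => /and3P[lea lec lec'].
  move=> S rg EJ sim.
  have [t1 [S1 [X1 T1 sim1 F1]]] := IH lec' S rg EJ sim.
  exists t1.+1, S1; split=> //.
  + by apply: ExecIfFalse X1; rewrite (eval_shift lea sim).
  + by rewrite mulSn; lia.
- move=> a c s cond /=; rewrite geq_max => /andP[lea lec] S rg EJ sim.
  exists 1%N, S; split=> //; rewrite ?mul1n //.
  by apply: ExecWhileFalse; rewrite (eval_shift lea sim).
- move=> a c s t s' t' s'' cond _ IH1 _ IH2 /=;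
  rewrite geq_max => /andP[lea lec].
  move=> S rg EJ sim.
  have [t1 [S1 [X1 T1 sim1 F1]]] := IH1 lec S rg EJ sim.
  have [||t2 [S2 [X2 T2 sim2 F2]]] := IH2 _ S1 (ranges_frame F1 rg) _ sim1.
  + by rewrite /= geq_max lea.
  + by rewrite F1.
  exists (t1 + t2).+1, S2; split=> //.
  + by apply: ExecWhileTrue X1 X2; rewrite (eval_shift lea sim).
  + by rewrite mulSn mulnDl; lia.
  + by move=> y lt; rewrite F2 ?F1.
Qed.

End Simulation.

Lemma exec_reset o D l s : exists2 s' : store,
  exec o (seqs [seq Assign (D + x) Nil_ | x <- l]) s (size l).+1 s' &
  forall y, s' y = if (D <= y)%N && (y - D \in l)%N then Leaf else s y.
Proof.
elim: l s => [|x l IH] s.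
  by exists s; [apply: ExecSkip | move=> y; rewrite andbF].
have [s' X V] := IH (update s (D + x)%N Leaf); exists s'.
  by rewrite /= -add1n; apply: ExecSeq X; apply: ExecAssign.
move=> y; rewrite V inE /update.
have -> : (y == (D + x)%N) = (D <= y)%N && (y - D == x)%N by lia.
by case: (D <= y)%N; case: (_ == x); case: (_ \in l).
Qed.

Lemma call_progP P L J t d s (out : data) :
  (n <= L)%N -> (m <= L)%N -> (60 <= d)%N -> ranges s ->
  dec_bundles (s d) = J ->
  run (value_oracle (restrict v J)) P (ca_input R n m) t out ->
  exists t' s', [/\ exec (value_oracle v) (call_prog P d) s t' s',
    (t' <= call_cost P L t)%N, s' d = out
    & forall y, (y < d)%N -> s' y = s y].
Proof.
move=> le_nL le_mL d60 rg EJ [s1 X1 <-].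
set N := (prog_vars P).+1.
have [S1 Y1 V1] := exec_reset (value_oracle v) d.+1 (iota 0 N) s.
have F1 y : (y <= d)%N -> S1 y = s y.
  by move=> le; rewrite V1 ltnNge le.
set S2 := update S1 d.+1 (ca_input R n m).
have F2 y : (y < d.+1)%N -> S2 y = s y.
  by move=> lt; rewrite /S2 update_neq ?F1 // ltn_eqF.
have rg2 : ranges S2 by apply: (@ranges_agree R n m d.+1) rg => //; lia.
have [|||t3 [S3 [Y3 T3 sim3 F3]]] := @restrict_progP J L d.+1 d N le_nL le_mL
    d60 (ltnSn d) P _ t s1 X1 _ S2 rg2.
- by rewrite /N.
- by rewrite F2.
- move=> x lt; rewrite /S2 /update addnC -[X in _ == X]add0n eqn_add2r addnC.
  case: eqP => // _; rewrite V1 leq_addr addKn mem_iota /= add0n.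
  by move: lt => /= ->.
exists (N.+1 + (1 + (t3 + (1 + 1))))%N, (update S3 d (S3 d.+1)); split.
- have <- : size (iota 0 N) = N by rewrite size_iota.
  apply: ExecSeq Y1 _; apply: ExecSeq; first exact: ExecAssign.
  have -> : update S1 d.+1 (eval S1 (Cons (Var 1) (Cons (Var 2) Nil_))) = S2.
    rewrite /= !F1; try lia.
    by case: rg => -> -> _ _.
  apply: ExecSeq Y3 _; apply: ExecSeq; first exact: ExecAssign.
  exact: ExecSkip.
- by rewrite /call_cost /N; lia.
- by rewrite update_eq -(sim3 0%N) ?addn0.
- by move=> y lt; rewrite update_neq ?ltn_eqF // F3 ?F2 //; lia.
Qed.

End Call.

(** * The auction program *)

Definition loopless (T : eqType) (E : rel T) : rel T :=
  fun i j => E i j && (i != j).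

Section Best.

Variables (R : realType) (f : ca_algorithm R) (n m : nat).
Implicit Types (v : profile R n m) (J : bundles n m).

Definition bidder_bundles (C : bundles n n) (t : 'I_n) : bundles n m :=
  [ffun i => if i \in C t then setT else set0].

Definition item_bundles (C : bundles m m) (t : 'I_m) : bundles n m :=
  [ffun=> C t].

(** Both families are always tried, which yields the minimum of the two degrees without computing
    it. *)
Definition candidates (x0 : 'I_n) (y0 : 'I_m) (E : rel 'I_n) (EI : rel 'I_m) :
    seq (bundles n m) :=
  [seq bidder_bundles (colour_classes R x0 (loopless E)) t | t <- enum 'I_n] ++
  [seq item_bundles (colour_classes R y0 (loopless EI)) t | t <- enum 'I_m].

(** On restricted valuations [f] may hand bidder [i] items outside [J i]. They add no value there
    but could cause conflicts; the intersection removes them. *)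
Definition masked v J : bundles n m :=
  [ffun i => f (restrict v J) i :&: J i].

(** The search compares welfare without conflicts, which for these conflict-free outcomes is also
    the welfare with conflicts. *)
Definition best_masked x0 y0 E EI v : bundles n m :=
  (foldl (keep_best (welfare (@plain_value R n m) v)) ([ffun=> set0], 0)
     [seq masked v J | J <- candidates x0 y0 E EI]).1.

End Best.

Definition FLoopless r a :=
  FMap r 21 22 (FMap r 23 24
    (FBool (FAnd (FNth r (FNth r a (FVar 21)) (FVar 23))
                 (FNot (FEq r (FVar 21) (FVar 23)))))).

(* Variables 60 and 61 hold the colour classes of bidders and items, 63 the
   index of a class, 64 the best allocation so far with its welfare, 65 the
   bundles under consideration and 66 the outcome of [f] for them. *)
Definition FBidderBundles :=
  FMap false 21 22
    (FIf (FNth false (FNth false (FVar 60) (FVar 63)) (FVar 21))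
       (FMap true 23 24 FTrue) (FMap true 23 24 FNil)).

Definition FItemBundles := FMap false 21 22 (FNth true (FVar 61) (FVar 63)).

Definition FMasked :=
  FMap false 21 22 (FMap true 23 24
    (FBool (FAnd (FNth true (FNth false (FVar 66) (FVar 21)) (FVar 23))
                 (FNth true (FNth false (FVar 65) (FVar 21)) (FVar 23))))).

Definition FConsider a :=
  FLet 65 a (FLet 66 (FCall (FVar 65)) (FLet 67 FMasked
    (FLet 68 (FSum false 21 22
                (FQuery (FCons (FVar 21) (FNth false (FVar 67) (FVar 21)))))
       (FIf (FPure (Le (Tl (Var 64)) (Var 68)))
          (FPure (Cons (Var 67) (Var 68))) (FVar 64))))).

Definition FMain :=
  FLet 60 (FLet 20 (FLoopless false (FPure (Hd (Tl (Tl (Var 0))))))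
             (FColour false))
    (FLet 61 (FLet 20 (FLoopless true (FPure (Hd (Tl (Tl (Tl (Var 0)))))))
                (FColour true))
      (FLet 62
        (FFold true 63 64
          (FFold false 63 64
            (FCons (FMap false 21 22 (FMap true 23 24 FNil)) FZero)
            (FConsider FBidderBundles))
          (FConsider FItemBundles))
        (FPure (Hd (Var 62))))).

(** Counting down and putting each number in front makes the list increasing; variable 5 is the
    counter. *)
Definition range_prog (x y : nat) : prog :=
  seqs [:: Assign y Nil_; Assign 5 (Var x);
           While (Var 5) (seqs [:: Assign 5 (Tl (Var 5));
                                   Assign y (Cons (Var 5) (Var y))])].

(** The offset 80 exceeds every variable occurring in [FMain]. *)
Definition main_prog (P : prog) : prog :=
  seqs [:: Assign 1 (Hd (Var 0)); Assign 2 (Hd (Tl (Var 0)));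
           range_prog 1 3; range_prog 2 4;
           compile (call_prog P) FMain 80; Assign 0 (Var 80)].

Definition main_cost (P : prog) (L t : nat) : nat :=
  (8 * L + 20 + cost FMain L (call_cost P L t))%N.

(** * Correctness and running time of the auction program *)

Section MainProgram.

Variables (R : realType) (f : ca_algorithm R) (P : prog) (n m : nat).
Variable (v : profile R n m).
Local Notation data := (data R).
Local Notation store := (store R).
Local Notation ranges := (@ranges R n m).
Implicit Types (s : store) (J : bundles n m).

Definition masked_call (d : data) : data :=
  enc_bundles R (f (restrict v (dec_bundles n m d))).

Local Notation sem := (sem (value_oracle v) masked_call).

Definition enc_scored (p : bundles n m * R) : data :=
  Node (enc_bundles R p.1) (Atom p.2).

(** The term [a] is evaluated inside two loops, in a store that differs from [s]; hence the
    condition that its value is determined by variable 0. *)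
Lemma sem_loopless r a s (E : rel 'I_(rsize n m r)) : ranges s ->
  (forall s', s' 0%N = s 0%N -> sem a s' = enc_rel R E) ->
  sem (FLoopless r a) s = enc_bundles R (out_neighbours (loopless E)).
Proof.
move=> rg Ha; apply: sem_map_bundles => // i acc.
apply: sem_map_set => [|j acc']; first by range_update.
set s1 := update _ _ _; have rg1 : ranges s1 by range_update.
rewrite sem_and sem_not (sem_eq (i := i) (j := j)) // ffunE inE.
congr (_ && _); rewrite (sem_mem (A := [set j | E i j]) (i := j)) ?inE //.
rewrite (sem_nth (F := fun i => enc_set R [set j | E i j]) (i := i)) //.
exact: Ha.
Qed.

Lemma sem_bidder_bundles s C t : ranges s ->
  s 60 = enc_bundles R C -> s 63 = enc_nat R (t : 'I_n) ->
  sem FBidderBundles s = enc_bundles R (bidder_bundles m C t).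
Proof.
move=> rg E60 E63.
apply: (sem_map_bundles (n := n) (m := m) (r := false)) => // i acc.
set s1 := update _ _ _; have rg1 : ranges s1 by range_update.
rewrite sem_if (sem_mem (n := n) (m := m) (r := false) (A := C t) (i :=
  i)) //; last first.
  exact: (sem_row (n := n) (m := m) (r := false) (S := C)).
rewrite ffunE; case: ifP => _.
  by apply: (sem_map (n := n) (m := m) (r := true)) => // k acc'; rewrite inE.
by apply: (sem_map (n := n) (m := m) (r := true)) => // k acc'; rewrite inE.
Qed.

Lemma sem_item_bundles s C t : ranges s ->
  s 61 = enc_bundles R C -> s 63 = enc_nat R (t : 'I_m) ->
  sem FItemBundles s = enc_bundles R (item_bundles n C t).
Proof.
move=> rg E61 E63.
apply: (sem_map_bundles (n := n) (m := m) (r := false)) => // i acc.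
set s1 := update _ _ _; have rg1 : ranges s1 by range_update.
by rewrite ffunE (sem_row (n := n) (m := m) (r := true) (S := C) (i := t)).
Qed.

Lemma sem_masked s J S : ranges s ->
  s 65 = enc_bundles R J -> s 66 = enc_bundles R S ->
  sem FMasked s = enc_bundles R ([ffun i => S i :&: J i] : bundles n m).
Proof.
move=> rg E65 E66.
apply: (sem_map_bundles (n := n) (m := m) (r := false)) => // i acc.
apply: (sem_map_set (n := n) (m := m) (r := true)) => [|k acc'];
  first by range_update.
set s1 := update _ _ _; have rg1 : ranges s1 by range_update.
rewrite sem_and ffunE inE.
rewrite (sem_mem (n := n) (m := m) (r := true) (A := S i) (i := k)) //;
  last first.
  exact: (sem_row (n := n) (m := m) (r := false) (S := S)).
rewrite (sem_mem (n := n) (m := m) (r := true) (A := J i) (i := k)) //.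
exact: (sem_row (n := n) (m := m) (r := false) (S := J)).
Qed.

Lemma value_oracle_enc (i : 'I_n) (A : {set 'I_m}) :
  value_oracle v (enc_nat R i) (enc_set R A) = Atom (v i A).
Proof.
rewrite /value_oracle dec_enc_nat insubT //= => lt; rewrite enc_setK.
by congr (Atom (v _ _)); apply: val_inj.
Qed.

Lemma sem_consider a s J p : ranges s ->
  sem a s = enc_bundles R J -> s 64 = enc_scored p ->
  sem (FConsider a) s =
  enc_scored (keep_best (welfare (@plain_value R n m) v) p (masked f v J)).
Proof.
move=> rg Ea E64; rewrite /FConsider sem_let Ea.
set s1 := update _ _ _; have rg1 : ranges s1 by range_update.
rewrite sem_let; have -> : sem (FCall (FVar 65)) s1 = enc_bundles R (f
  (restrict v J)).
  by rewrite -[sem _ _]/(masked_call (enc_bundles R J)) /masked_call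
    enc_bundlesK.
set s2 := update _ _ _; have rg2 : ranges s2 by range_update.
rewrite sem_let (@sem_masked s2 J (f (restrict v J))) //.
set s3 := update _ _ _; have rg3 : ranges s3 by range_update.
rewrite sem_let.
rewrite (@sem_sum _ _ _ n m false _ _ _ _
  (fun i => plain_value (v i) (masked f v J) i)) // => [|i acc].
  case: p E64 => S z E64;
    rewrite sem_if /keep_best /= /s3 /s2 /s1 /update /= E64 /=.
  by rewrite truth_enc_bool; case: ifP.
set s4 := update _ _ _; have rg4 : ranges s4 by range_update.
have -> b : sem (FQuery (FCons (FVar 21) b)) s4 =
  value_oracle v (sem (FVar 21) s4) (sem b s4) by [].
rewrite (@sem_row _ _ _ n m false _ _ _ _ (masked f v J) i) //.
exact: value_oracle_enc.
Qed.

Lemma sem_main s (x0 : 'I_n) (y0 : 'I_m) (E : rel 'I_n) (EI : rel 'I_m) :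
  x0 = 0%N :> nat -> y0 = 0%N :> nat ->
  ranges s -> s 0%N = cac_input R E EI ->
  sem FMain s = enc_bundles R (best_masked f x0 y0 E EI v).
Proof.
move=> x00 y00 rg E0; rewrite /FMain sem_let [sem (FLet 20 _ _) _]sem_let.
rewrite (@sem_loopless false _ _ E) //; last first.
  by move=> s'; rewrite E0 => /= ->.
rewrite (@sem_colour _ _ _ n m false x0 (loopless E)) //.
set s1 := update s 60 _; have rg1 : ranges s1 by range_update.
rewrite sem_let [sem (FLet 20 _ _) _]sem_let.
rewrite (@sem_loopless true _ _ EI) //; last first.
  by move=> s' /=; rewrite /s1 /update /= E0 => ->.
rewrite (@sem_colour _ _ _ n m true y0 (loopless EI)) //.
set s2 := update s1 61 _; have rg2 : ranges s2 by range_update.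
rewrite sem_let /best_masked; set p := foldl _ _ _.
suff H : sem (FFold true 63 64
          (FFold false 63 64
            (FCons (FMap false 21 22 (FMap true 23 24 FNil)) FZero)
            (FConsider FBidderBundles))
          (FConsider FItemBundles)) s2 = enc_scored p.
  exact: (congr1 (@data_head R) H).
rewrite /p /candidates map_cat foldl_cat -2!map_comp 2!foldl_map.
rewrite !(sem_fold _ _ _ _ _ _ _ rg2).
have -> : sem (FCons (FMap false 21 22 (FMap true 23 24 FNil)) FZero) s2
        = enc_scored ([ffun=> set0], 0).
  rewrite sem_cons; congr Node.
  apply: (sem_map_bundles (n := n) (m := m) (r := false)) => // i acc.
  rewrite ffunE; apply: (sem_map (n := n) (m := m) (r := true)) => [|k acc'].
    by range_update.
  by rewrite inE.
set q := foldl _ (enc_scored _) _.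
have -> : q = enc_scored (foldl (fun y t => keep_best (welfare (@plain_value R
  n m) v) y
   (masked f v (bidder_bundles m (colour_classes R x0 (loopless E)) t)))
     ([ffun=> set0], 0) (enum 'I_n)).
  rewrite /q; apply: foldl_morph => p' t.
  set s3 := update _ _ _; have rg3 : ranges s3 by range_update.
  apply: sem_consider => //.
  exact: sem_bidder_bundles.
apply: foldl_morph => p' t.
set s3 := update _ _ _; have rg3 : ranges s3 by range_update.
apply: sem_consider => //.
exact: sem_item_bundles.
Qed.

Lemma exec_range_prog o x y j s : (x < 5)%N -> (y < 5)%N -> x != y ->
  s x = enc_nat R j ->
  exists t s', [/\ exec o (range_prog x y) s t s', (t <= 4 * j + 4)%N,
    s' y = enc_range R j & forall z, (z < 5)%N -> z != y -> s' z = s z].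
Proof.
move=> x5 y5 nexy Ex.
pose body := seqs [:: Assign 5 (Tl (Var 5)); Assign y (Cons (Var 5) (Var y))].
(* With counter [i], variable [y] already holds the [k] numbers from [i] on. *)
have loop i : forall k s0, s0 5%N = enc_nat R i ->
    s0 y = enc_seq [seq enc_nat R l | l <- iota i k] ->
    exists t s', [/\ exec o (While (Var 5) body) s0 t s', (t <= 4 * i + 1)%N,
      s' y = enc_range R (i + k)
      & forall z, (z < 5)%N -> z != y -> s' z = s0 z].
  elim: i => [|i IH] k s0 E5 Ey.
    exists 1%N, s0; split=> //; by apply: ExecWhileFalse; rewrite /= E5.
  set s1 := update s0 5 (enc_nat R i).
  set s2 := update s1 y (Node (enc_nat R i) (s0 y)).
  have [||t [s' [X T V F]]] := IH k.+1 s2.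
  - by rewrite /s2 update_neq // gtn_eqF.
  - by rewrite /s2 update_eq Ey.
  exists (1 + (1 + 1) + t).+1, s'; split.
  - apply: ExecWhileTrue X; first by rewrite /= E5.
    apply: ExecSeq; first exact: ExecAssign.
    have -> : update s0 5 (eval s0 (Tl (Var 5))) = s1 by rewrite /s1 /= E5.
    apply: ExecSeq; last exact: ExecSkip.
    have -> : s2 = update s1 y (eval s1 (Cons (Var 5) (Var y))).
      by rewrite /s2 /s1 /= (@update_neq _ _ _ _ y) ?ltn_eqF.
    exact: ExecAssign.
  - by lia.
  - by rewrite V addSnnS.
  - by move=> z z5 nzy; rewrite F // /s2 update_neq // /s1 update_neq ?ltn_eqF.
set s1 := update s y Leaf; set s2 := update s1 5 (enc_nat R j).
have [||t [s' [X T V F]]] := loop j 0%N s2.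
- by rewrite /s2 update_eq.
- by rewrite /s2 update_neq ?ltn_eqF // /s1 update_eq.
exists (1 + (1 + (t + 1)))%N, s'; split.
- apply: ExecSeq; first exact: ExecAssign.
  apply: ExecSeq; first exact: ExecAssign.
  have -> : update (update s y (eval s Nil_)) 5
     (eval (update s y (eval s Nil_)) (Var x)) = s2.
    by rewrite /s2 /= update_neq ?Ex.
  apply: ExecSeq X _; exact: ExecSkip.
- by lia.
- by rewrite V addn0.
- by move=> z z5 nzy; rewrite F // /s2 update_neq ?ltn_eqF // /s1 update_neq.
Qed.

Lemma run_main L T (x0 : 'I_n) (y0 : 'I_m) (E : rel 'I_n) (EI : rel 'I_m) :
  x0 = 0%N :> nat -> y0 = 0%N :> nat -> (n <= L)%N -> (m <= L)%N ->
  (forall J, exists2 t, (t <= T)%N & run (value_oracle (restrict v J)) P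
     (ca_input R n m) t (enc_bundles R (f (restrict v J)))) ->
  exists2 t, (t <= main_cost P L T)%N & run (value_oracle v) (main_prog P)
    (cac_input R E EI) t (enc_bundles R (best_masked f x0 y0 E EI v)).
Proof.
move=> x00 y00 le_nL le_mL runP.
pose s0 := update (fun=> Leaf) 0%N (cac_input R E EI).
set s1 := update s0 1 (enc_nat R n); set s2 := update s1 2 (enc_nat R m).
have [|||//|t3 [s3 [X3 T3 V3 F3]]] :=
  @exec_range_prog (value_oracle v) 1 3 n s2 => //.
have [|||//|t4 [s4 [X4 T4 V4 F4]]] :=
  @exec_range_prog (value_oracle v) 2 4 m s3 => //.
  by rewrite F3.
have rg4 : ranges s4 by split; rewrite ?V4 // F4 // ?V3 // F3.
have E40 : s4 0%N = cac_input R E EI by rewrite F4 // F3.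
have [||||||t5 [s5 [X5 T5 V5 _]]] := @compileP R (call_prog P) (value_oracle v)
  masked_call n m L (call_cost P L T) 80 le_nL le_mL _ FMain _ _ 80 s4 s4 => //.
  move=> d s d80 rg.
  have [t le_t H] := runP (dec_bundles n m (s d)).
  have [|t' [s' [X' T' V' F']]] := call_progP le_nL le_mL _ rg erefl H.
    exact: leq_trans d80.
  exists t', s'; split=> //; apply: leq_trans T' _.
  by rewrite /call_cost leq_add2r leq_add2l leq_mul2r le_t orbT.
exists (1 + (1 + (t3 + (t4 + (t5 + (1 + 1))))))%N.
  by rewrite /main_cost; lia.
exists (update s5 0 (s5 80)); last first.
  by rewrite update_eq V5 (sem_main x00 y00 rg4 E40).
apply: ExecSeq; first exact: ExecAssign.
apply: ExecSeq; first exact: ExecAssign.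
apply: ExecSeq X3 _; apply: ExecSeq X4 _; apply: ExecSeq X5 _.
apply: ExecSeq; first exact: ExecAssign.
exact: ExecSkip.
Qed.

End MainProgram.

Lemma poly_bounded_main P T :
  poly_bounded T -> poly_bounded (fun L => main_cost P L (T L)).
Proof.
move=> polyT; rewrite /main_cost /call_cost.
have polyq : poly_bounded query_cost.
  apply: poly_bounded_add; last exact: poly_bounded_const.
  by apply: poly_bounded_cost; apply: poly_bounded_const.
apply: poly_bounded_add.
  by repeat first [exact: poly_bounded_const | exact: poly_bounded_id
    | apply: poly_bounded_add | apply: poly_bounded_mul].
apply: poly_bounded_cost.
by repeat first [exact: poly_bounded_const | exact: polyT | exact: polyq
    | apply: poly_bounded_add | apply: poly_bounded_mul].
Qed.

(** * Approximation and truthfulness *)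

Section Valuations.

Variables (R : realType) (m : nat) (u : valuation R m).
Hypothesis adm : admissible u.

(** Fractional sub-additivity with all weights equal to 1. *)
Lemma admissible_cover k (S : {set 'I_m}) (T : 'I_k -> {set 'I_m}) :
  (forall j, j \in S -> exists t, j \in T t) -> u S <= \sum_t u (T t).
Proof.
move=> cov; case: adm => _ sub.
have := sub S k T (fun=> 1) _ _; rewrite (eq_bigr (fun t => u (T t))) => [|t _].
  apply=> [l|j /cov[t jt]]; first by rewrite ler01 lexx.
  by rewrite (bigD1 t) //= lerDl sumr_ge0.
by rewrite mul1r.
Qed.

Lemma admissible_set0 : u set0 = 0.
Proof.
apply/eqP; rewrite eq_le; case: (adm) => pos _; rewrite pos andbT.
have := @admissible_cover 0 set0 (fun=> set0); rewrite big_ord0; apply.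
by move=> j; rewrite inE.
Qed.

Lemma admissible_mono (S T : {set 'I_m}) : S \subset T -> u S <= u T.
Proof.
move=> /subsetP sST; have := @admissible_cover 1 S (fun=> T).
by rewrite big_ord1; apply=> j /sST jT; exists ord0.
Qed.

(** If the weighted sets [T l] cover [S], then the sets [T l :&: J] with the same weights cover
    [S :&: J]. This is what allows [f] to be run on restricted valuations. *)
Lemma admissible_setI (J : {set 'I_m}) : admissible (fun A => u (A :&: J)).
Proof.
case: adm => pos sub; split=> [A|S k T a a01 cov]; first exact: pos.
apply: sub => // j; rewrite inE => /andP[jS jJ].
apply: le_trans (cov j jS) _; rewrite le_eqVlt; apply/orP; left; apply/eqP.
by apply: eq_bigl => l; rewrite inE jJ andbT.
Qed.

End Valuations.

Lemma loopless_outdegree (T : finType) (E : rel T) :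
  (max_outdegree (loopless E) <= max_outdegree E)%N.
Proof.
apply/bigmax_leqP => x _.
apply: leq_trans (leq_bigmax (F := fun x : T => #|[set y | E x y]|) x).
by apply: subset_leq_card; apply/subsetP => y; rewrite !inE => /andP[].
Qed.

Lemma card_ord_leq k d : (#|[pred t : 'I_k | (t <= d)%N]| <= d.+1)%N.
Proof.
rewrite cardE -(size_map val) -[d.+1](size_iota 0).
apply: uniq_leq_size; first by rewrite map_inj_uniq ?enum_uniq //;
  apply: val_inj.
by move=> _ /mapP[t + ->]; rewrite mem_enum mem_iota inE.
Qed.

Section Welfare.

Variables (R : realType) (f : ca_algorithm R) (n m : nat) (alpha : R).
Hypothesis alpha_ge1 : 1 <= alpha.
Hypothesis f_approx : approximates (@plain_value R n m) alpha (f (n :=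
  n) (m := m)).
Implicit Types (v : profile R n m) (J S : bundles n m).
Local Notation plain := (@plain_value R n m).

Lemma admissible_restrict v J :
  admissible_profile v -> admissible_profile (restrict v J).
Proof. by move=> adm i; apply: admissible_setI. Qed.

Definition mask S J : bundles n m := [ffun i => S i :&: J i].

Lemma maskedE v J : masked f v J = mask (f (restrict v J)) J.
Proof. by []. Qed.

Lemma welfare_mask v S J : welfare plain v (mask S J) = welfare plain (restrict
  v J) S.
Proof. by apply: eq_bigr => i _; rewrite /plain_value ffunE. Qed.

Lemma is_allocation_mask S J : is_allocation S -> is_allocation (mask S J).
Proof.
move=> /forallP allS; apply/forallP => i; apply/forallP => j;
  apply/implyP => nij.
have /forallP/(_ j)/implyP/(_ nij) := allS i; rewrite !ffunE.
by move=> dis; apply: disjointWl (subsetIl _ _) _;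
  apply: disjointWr (subsetIl _ _) _.
Qed.

Lemma is_allocation_empty : is_allocation ([ffun=> set0] : bundles n m).
Proof.
by apply/forallP => i; apply/forallP => j; apply/implyP => _;
  rewrite !ffunE disjoints_subset sub0set.
Qed.

Lemma le_optimum v S : is_allocation S -> welfare plain v S <= optimum plain v.
Proof. by move=> allS;
  apply: (le_bigmax_cond _ (fun S => welfare plain v S)). Qed.

(* Summing over a covering family [J] of restrictions loses nothing, by
   subadditivity. *)
Lemma welfare_cover k (J : 'I_k -> bundles n m) d W v S :
  admissible_profile v -> is_allocation S ->
  (forall i j, exists t, j \in J t i) ->
  (forall t i j, j \in J t i -> (t <= d)%N) ->
  0 <= W -> (forall t, welfare plain v (masked f v (J t)) <= W) ->
  welfare plain v S <= d.+1%:R * (alpha * W).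
Proof.
move=> adm allS cov bnd W0 leW.
have alpha_gt0 : 0 < alpha by apply: lt_le_trans alpha_ge1.
apply: (@le_trans _ _ (\sum_t welfare plain (restrict v (J t)) S)).
  rewrite exchange_big; apply: ler_sum => i _.
  apply: admissible_cover => // j jS; have [t jt] := cov i j.
  by exists t; rewrite inE jS.
(* Beyond index [d] the restrictions are empty, so at most [d.+1] terms remain. *)
apply: (@le_trans _ _ (\sum_(t < k) if (t <= d)%N then alpha * W else 0)).
  apply: ler_sum => t _; case: ifPn => [le_td|gt_td]; last first.
    rewrite /welfare big1 // => i _; rewrite /plain_value /restrict.
    have -> : S i :&: J t i = set0; last exact: admissible_set0.
    by apply/setP => j; rewrite !inE andbC; apply/negbTE;
      apply: contra gt_td => /andP[/bnd].
  (* [S] competes in the restricted auction, on which [f] loses at most a factor [alpha]; masking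
     its outcome by [J t] keeps that welfare. *)
  have [_ app] := f_approx (admissible_restrict (J t) adm).
  apply: le_trans (le_optimum _ allS) _.
  rewrite -ler_pdivrMl //; apply: le_trans app _.
  by rewrite -welfare_mask -maskedE.
rewrite -big_mkcond sumr_const -[_ *+ _]mulr_natl ler_wpM2r //.
  by rewrite mulr_ge0 // ltW.
by rewrite ler_nat card_ord_leq.
Qed.

Section Conflicts.

Variables (x0 : 'I_n) (y0 : 'I_m) (E : rel 'I_n) (EI : rel 'I_m).
Hypothesis graphs : conflict_graphs E EI.
Local Notation conflict := (@conflict_value R n m E EI).
Local Notation best := (best_masked f x0 y0 E EI).
Local Notation cands := (candidates R x0 y0 E EI).

(** Only distinct items count: in an allocation different bidders never hold the same item, so a
    loop of [EI] causes no conflict. *)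
Definition conflict_free J : Prop :=
  forall i j k l, E i j -> k != l -> k \in J i -> l \in J j -> ~~ EI k l.

Lemma loopless_irr (T : eqType) (F : rel T) : irreflexive (loopless F).
Proof. by move=> x; rewrite /loopless eqxx andbF. Qed.

Lemma candidates_conflict_free J : J \in cands -> conflict_free J.
Proof.
have [E_irr _ _] := graphs.
rewrite mem_cat => /orP[] /mapP[t _ ->] i j k l Eij nkl; rewrite !ffunE.
  case: ifP => [it _|]; last by rewrite inE.
  case: ifP => [jt _|]; last by rewrite inE.
  have [_ ind _] := colour_classesP R x0 (@loopless_irr _ E).
  have := ind _ _ _ it jt; rewrite /loopless Eij /=; case: eqP => // eij.
  by rewrite eij E_irr in Eij.
move=> kt lt; have [_ ind _] := colour_classesP R y0 (@loopless_irr _ EI).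
by have := ind _ _ _ kt lt; rewrite /loopless nkl andbT.
Qed.

(** Conflicting bidders are distinct because [E] is irreflexive; disjointness then makes their items
    distinct, so [conflict_free] applies. *)
Lemma useless_mask S J : is_allocation S -> conflict_free J ->
  forall i, useless E EI (mask S J) i = set0.
Proof.
have [E_irr _ _] := graphs.
move=> /forallP allS cfJ i; apply/setP => k; rewrite !inE; apply/negbTE.
apply/negP => /andP[ki /existsP[j /existsP[l /and3P[lj Eij EIkl]]]].
move: ki lj; rewrite !ffunE !inE => /andP[kSi kJi] /andP[lSj lJj].
have nij : i != j by apply: contraTneq Eij => ->; rewrite E_irr.
have nkl : k != l.
  have /forallP/(_ j)/implyP/(_ nij) := allS i; move=> dis.
  by apply: contraTneq lSj => <-; rewrite (disjointFr dis kSi).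
by have := cfJ _ _ _ _ Eij nkl kJi lJj; rewrite EIkl.
Qed.

Lemma conflict_welfare_mask v S J : is_allocation S -> conflict_free J ->
  welfare conflict v (mask S J) = welfare plain v (mask S J).
Proof.
move=> allS cfJ; apply: eq_bigr => i _.
by rewrite /conflict_value useless_mask // setD0.
Qed.

Lemma conflict_welfare_empty v : admissible_profile v ->
  welfare conflict v [ffun=> set0] = 0.
Proof.
move=> adm; apply: big1 => i _.
by rewrite /conflict_value ffunE set0D admissible_set0.
Qed.

Lemma conflict_welfare_le v S : admissible_profile v ->
  welfare conflict v S <= welfare plain v S.
Proof. by move=> adm; apply: ler_sum => i _;
  apply: admissible_mono (subsetDl _ _). Qed.

Lemma f_alloc v J : admissible_profile v -> is_allocation (f (restrict v J)).
Proof. by move=> adm; case: (f_approx (admissible_restrict J adm)). Qed.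

Lemma bestP v : admissible_profile v ->
  [/\ best v = [ffun=> set0] \/ exists2 J, J \in cands & best v = masked f v J,
      0 <= welfare conflict v (best v)
    & forall J, J \in cands ->
        welfare plain v (masked f v J) <= welfare conflict v (best v)].
Proof.
move=> adm; rewrite /best_masked.
set l := map _ _; set p := foldl _ _ _.
have [H1 H2 H3] : [/\ forall S, S \in l -> welfare plain v S <= p.2, 0 <= p.2
   & p = ([ffun=> set0], 0) \/ p.1 \in l /\ p.2 = welfare plain v p.1].
  exact: keep_bestP.
have {}H3 : (p.1 = [ffun=> set0] \/ exists2 J, J \in cands & p.1 = masked f v J)
    /\ welfare conflict v p.1 = p.2.
  case: H3 => [->|[/mapP[J Jc Ep] ->]] /=.
    by split; [left | apply: conflict_welfare_empty].
  split; first by right; exists J.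
  rewrite Ep maskedE; apply: conflict_welfare_mask; first exact: f_alloc.
  exact: candidates_conflict_free.
case: H3 => H3 ->; split=> // J Jc; apply: H1; exact: map_f.
Qed.

Lemma best_alloc v : admissible_profile v -> is_allocation (best v).
Proof.
move=> adm; have [[->|[J _ ->]] _ _] := bestP adm;
  first exact: is_allocation_empty.
by apply: is_allocation_mask; apply: f_alloc.
Qed.

Lemma best_approximates :
  approximates conflict
    (16 * alpha / 3 * (minn (max_outdegree E) (max_outdegree EI))%:R) best.
Proof.
move=> v adm; split; first exact: best_alloc.
have [_ W0 leW] := bestP adm; set W := welfare conflict v (best v) in W0 leW *.
have [E_irr dE dEI] := graphs.
set D := minn _ _; have D_ge1 : (1 <= D)%N by rewrite leq_min dE.
have aW0 : 0 <= alpha * W by rewrite mulr_ge0 // (le_trans ler01).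
have key S : is_allocation S -> welfare conflict v S <= (D.*2.+1)%:R * (alpha *
  W).
  move=> allS; apply: le_trans (conflict_welfare_le S adm) _.
  (* Cover with the colour classes of whichever graph attains the minimum, with [d] twice its
     degree. *)
  rewrite /D; case: (leqP (max_outdegree E) (max_outdegree EI)) => _.
    have [cov _ bnd] := colour_classesP R x0 (@loopless_irr _ E).
    apply: (@welfare_cover n (bidder_bundles m (colour_classes R x0 (loopless
      E)))) => //.
    - by move=> i j; have [t it] := cov i; exists t; rewrite ffunE it inE.
    - move=> t i j; rewrite ffunE; case: ifP => [/bnd le_t _|];
      last by rewrite inE.
      by apply: leq_trans le_t _; rewrite leq_double loopless_outdegree.
    - by move=> t; apply: leW; rewrite mem_cat map_f ?mem_enum.
  have [cov _ bnd] := colour_classesP R y0 (@loopless_irr _ EI).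
  apply: (@welfare_cover m (item_bundles n (colour_classes R y0 (loopless
    EI)))) => //.
  - by move=> i j; have [t jt] := cov j; exists t; rewrite ffunE.
  - move=> t i j; rewrite ffunE => /bnd le_t.
    by apply: leq_trans le_t _; rewrite leq_double loopless_outdegree.
  - by move=> t; apply: leW; rewrite mem_cat orbC map_f ?mem_enum.
have D_gt0 : 1 <= D%:R :> R by rewrite ler1n.
have c_gt0 : 0 < 16 * alpha / 3 * D%:R by have := alpha_ge1; nra.
rewrite ler_pdivrMl //.
apply: (@le_trans _ _ ((D.*2.+1)%:R * (alpha * W))).
  by apply: bigmax_le => //; rewrite mulr_ge0.
have -> : 16 * alpha / 3 * D%:R * W = (16 / 3 * D%:R) * (alpha * W) by ring.
apply: ler_wpM2r => //; rewrite -addn1 natrD -mul2n natrM; lra.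
Qed.

(** The range consists of the empty allocation and the range [A] of [f] masked by the candidates. A
    masked allocation has the welfare of the unmasked one in the restricted auction, where [f] is
    optimal over [A]. *)
Lemma best_maximal_in_range :
  maximal_in_range plain (f (n := n) (m :=
    m)) -> maximal_in_range conflict best.
Proof.
case=> A [allA maxA].
exists [set S | (S == [ffun=> set0]) ||
   [exists J, (J \in cands) && [exists S0 in A, S == mask S0 J]]].
split=> [S|v adm].
  rewrite inE => /orP[/eqP->|/existsP[J /andP[_ /existsP[S0 /andP[S0A
    /eqP->]]]]].
    exact: is_allocation_empty.
  by apply: is_allocation_mask; apply: allA.
have [bE W0 leW] := bestP adm; split.
  rewrite inE; case: bE => [->|[J Jc ->]]; first by rewrite eqxx.
  apply/orP; right; apply/existsP; exists J; rewrite Jc /=.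
  apply/existsP; exists (f (restrict v J)); rewrite maskedE eqxx andbT.
  by case: (maxA _ (admissible_restrict J adm)).
move=> S; rewrite inE => /orP[/eqP->|]; first by rewrite conflict_welfare_empty.
case/existsP => J /andP[Jc /existsP[S0 /andP[S0A /eqP->]]].
rewrite conflict_welfare_mask; [|exact: allA|exact: candidates_conflict_free].
apply: le_trans (leW J Jc); rewrite maskedE !welfare_mask.
by case: (maxA _ (admissible_restrict J adm)) => _; apply.
Qed.

End Conflicts.

End Welfare.

(* Vickrey-Clarke-Groves: each bidder is paid the value of the others. *)
Lemma maximal_in_range_truthful (R : realType) n m (value : outcome_value R n m)
    (g : profile R n m -> bundles n m) :
  maximal_in_range value g -> truthful value g.
Proof.
case=> A [_ maxA].
exists (fun v i => - \sum_(j | j != i) value (v j) (g v) j) => v i w adm admw.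
have adm' : admissible_profile (misreport v i w).
  by move=> j; rewrite /misreport; case: eqP.
(* The outcome of the misreport also lies in [A], so under the true valuations it cannot beat the
   truthful outcome. *)
have [gA _] := maxA _ adm'; have [_ /(_ _ gA)] := maxA _ adm.
rewrite !opprK /welfare (bigD1 i) //= [X in _ <= X](bigD1 i) //=.
set s := \sum_(j < n | _) _; set s' := (X in _ -> _ + X <= _).
suff -> : s' = s by [].
by apply: eq_bigr => j nij; rewrite /misreport (negbTE nij).
Qed.

(** The colourings need a default bidder and a default item. If one is missing, no graphs satisfy
    [conflict_graphs], and the empty allocation is a dummy. *)
Definition conflict_algorithm (R : realType) (f : ca_algorithm R) :
    cac_algorithm R :=
  fun n m E EI v =>
    match insub 0%N : option 'I_n, insub 0%N : option 'I_m with
    | Some x0, Some y0 => best_masked f x0 y0 E EI v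
    | _, _ => [ffun=> set0]
    end.

Lemma conflict_algorithmE (R : realType) (f : ca_algorithm R) n m
    (E : rel 'I_n) (EI : rel 'I_m) : conflict_graphs E EI ->
  exists (x0 : 'I_n) (y0 : 'I_m), [/\ x0 = 0%N :> nat, y0 = 0%N :> nat
    & conflict_algorithm f E EI = best_masked f x0 y0 E EI].
Proof.
have pos k (F : rel 'I_k) : (1 <= max_outdegree F)%N -> (0 < k)%N.
  by case: k F => // F; rewrite /max_outdegree big_ord0.
case=> _ /pos n0 /pos m0; exists (Ordinal n0), (Ordinal m0); split=> //.
by rewrite /conflict_algorithm !insubT.
Qed.

Theorem theorem6 (R : realType) (alpha : nat -> nat -> R)
    (P : prog) (f : ca_algorithm R)
    (halpha : forall n m, 1 <= alpha n m)
    (hP : ca_computes P f)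
    (hf : forall n m, approximates (@plain_value R n m) (alpha n m) (f n m)) :
  exists (Pc : prog) (fc : cac_algorithm R),
    [/\ cac_computes Pc fc,
        forall (n m : nat) (E : rel 'I_n) (EI : rel 'I_m),
          conflict_graphs E EI ->
          approximates (@conflict_value R n m E EI)
            (16 * alpha n m / 3
               * (minn (max_outdegree E) (max_outdegree EI))%:R)
            (fc n m E EI),
        ca_polytime R P -> cac_polytime R Pc
      & (forall n m, maximal_in_range (@plain_value R n m) (f n m)) ->
        forall (n m : nat) (E : rel 'I_n) (EI : rel 'I_m),
          conflict_graphs E EI ->
          maximal_in_range (@conflict_value R n m E EI) (fc n m E EI) /\
          truthful (@conflict_value R n m E EI) (fc n m E EI)].
Proof.
exists (main_prog P), (conflict_algorithm f); split.
- move=> n m E EI v graphs adm.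
  have [x0 [y0 [x00 y00 ->]]] := conflict_algorithmE f graphs.
  (* No time bound is assumed here, but there are finitely many [J], so the running times have a
     maximum. *)
  have /fin_all_exists[t runP] (J : bundles n m) :=
    hP _ _ _ (admissible_restrict J adm).
  have [|t' _ run'] := @run_main R f P n m v (n + m) (\max_J t J)%N x0 y0 E EI
    x00 y00 (leq_addr _ _) (leq_addl _ _).
    by move=> J; exists (t J) => //; apply: leq_bigmax.
  by exists t'.
- move=> n m E EI graphs.
  have [x0 [y0 [_ _ ->]]] := conflict_algorithmE f graphs.
  exact: best_approximates.
- case=> c [k polyP].
  have [|c' [k' bound]] := @poly_bounded_main P (fun L => c * L.+1 ^ k)%N.
    by exists c, k.
  exists c', k' => n m E EI v graphs adm.
  have [x0 [y0 [x00 y00 _]]] := conflict_algorithmE f graphs.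
  have [|t le_t run'] := @run_main R f P n m v (n + m) (c * (n + m).+1 ^ k)%N
    x0 y0 E EI
    x00 y00 (leq_addr _ _) (leq_addl _ _).
    move=> J; have adm' := admissible_restrict J adm.
    have [t [d [[s X _] le_t]]] := polyP _ _ _ adm'.
    have [t' [s' X' E']] := hP _ _ _ adm'; exists t => //.
    (* By determinism the run within the time bound is the one that outputs the allocation of
       [f]. *)
    by exists s => //; have [_ ->] := exec_det X X'.
  by exists t, (enc_bundles R (best_masked f x0 y0 E EI v)); split=> //;
    apply: leq_trans (bound _).
- move=> mir n m E EI graphs.
  have [x0 [y0 [_ _ ->]]] := conflict_algorithmE f graphs.
  have H : maximal_in_range (@conflict_value R n m E EI) (best_masked f x0 y0 E
    EI).
    by apply: (best_maximal_in_range (hf n m)).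
  by split=> //; apply: maximal_in_range_truthful.
Qed.
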